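(* Let $F/\mathbb{Q}$ be a totally real Galois extension of degree $d = [F:\mathbb{Q}]$. Let $\Gamma \subseteq \mathrm{SL}_2(F)$ be a $\mathrm{Gal}(F/\mathbb{Q})$-stable arithmetic subgroup. Then every irreducible complex representation of the Galois group $\mathrm{Gal}(F/\mathbb{Q})$ occurs with arbitrarily large multiplicity in the cohomology $H^d(\Gamma_0,\mathbb{C})$ of a sufficiently small finite index subgroup $\Gamma_0\leq\Gamma$; that is, for every irreducible representation $\vartheta$ of $\mathrm{Gal}(F/\mathbb{Q})$ and every $B\in\mathbb{N}$ there is a finite index $\mathrm{Gal}(F/\mathbb{Q})$-stable subgroup $\Gamma_0\leq\Gamma$ such that $\vartheta$ occurs in $H^d(\Gamma_0,\mathbb{C})$ with multiplicity at least $B$.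
   Context: $\mathrm{Gal}(F/\mathbb{Q})$ acts on $\mathrm{SL}_2(F)$ entrywise. An arithmetic subgroup of $\mathrm{SL}_2(F)$ is a subgroup commensurable with $\mathrm{SL}_2(\mathcal{O}_F)$, where $\mathcal{O}_F$ is the ring of integers of $F$. If $\Gamma_0$ is stable under $\mathrm{Gal}(F/\mathbb{Q})$, the Galois group acts on $\Gamma_0$ by automorphisms and hence on $H^d(\Gamma_0,\mathbb{C})$. *)

(* Defs.v *)
From HB Require Import structures.
From mathcomp Require Import all_boot all_order all_algebra all_fingroup.
From mathcomp Require Import all_solvable all_field all_character.
From mathcomp Require Import boolp classical_sets functions cardinality reals.
From mathcomp Require Import complex.

Set Implicit Arguments.
Unset Strict Implicit.
Unset Printing Implicit Defensive.

Import Order.TTheory GRing.Theory Num.Theory.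

Local Open Scope ring_scope.

Section SpecialLinear.
Variables (n : nat) (R : comUnitRingType).

Record SL := MkSL { SL_mx :> 'M[R]_n; _ : \det SL_mx == 1 }.

HB.instance Definition _ := [isSub for SL_mx].
HB.instance Definition _ := [Choice of SL by <:].

Lemma SL_det (A : SL) : \det A = 1.
Proof. by apply/eqP; case: A. Qed.

Lemma SL_unit (A : SL) : (A : 'M_n) \in unitmx.
Proof. by rewrite unitmxE SL_det unitr1. Qed.

Lemma SL_mul_subproof (A B : SL) : \det (A *m B) == 1.
Proof. by rewrite det_mulmx !SL_det mulr1. Qed.

Lemma SL_one_subproof : \det (1%:M : 'M[R]_n) == 1.
Proof. by rewrite det1. Qed.

Lemma SL_inv_subproof (A : SL) : \det (invmx A) == 1.
Proof. by rewrite det_inv SL_det invr1. Qed.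

Definition SL_mul A B := MkSL (SL_mul_subproof A B).
Definition SL_one := MkSL SL_one_subproof.
Definition SL_inv A := MkSL (SL_inv_subproof A).

Lemma SL_mulA : associative SL_mul.
Proof. by move=> A B C; apply: val_inj; rewrite /= mulmxA. Qed.
Lemma SL_mul1 : left_id SL_one SL_mul.
Proof. by move=> A; apply: val_inj; rewrite /= mul1mx. Qed.
Lemma SL_mulr1 : right_id SL_one SL_mul.
Proof. by move=> A; apply: val_inj; rewrite /= mulmx1. Qed.
Lemma SL_mulV : left_inverse SL_one SL_inv SL_mul.
Proof. by move=> A; apply: val_inj; rewrite /= mulVmx ?SL_unit. Qed.
Lemma SL_mulrV : right_inverse SL_one SL_inv SL_mul.
Proof. by move=> A; apply: val_inj; rewrite /= mulmxV ?SL_unit. Qed.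

HB.instance Definition _ :=
  isGroup.Build SL SL_mulA SL_mul1 SL_mulr1 SL_mulV SL_mulrV.

End SpecialLinear.

(* A subgroup of a (possibly infinite) group G is an S : groupClosed G; here  *)
(* it is turned into a group of its own.                                      *)
Section Subgroups.
Variable G : groupType.

Definition subgroup_type (S : groupClosed G) := {x : G | x \in S}.

Lemma groupClosedP (S : groupClosed G) : group_closed S.
Proof.
by split; [exact: gpred1 | move=> x y Sx Sy; rewrite gpredM // gpredVr].
Qed.

HB.instance Definition _ (S : groupClosed G) :=
  SubChoice.copy (subgroup_type S) {x : G | x \in S}.
HB.instance Definition _ (S : groupClosed G) :=
  SubChoice_isSubGroup.Build G (fun x => x \in S) (subgroup_type S)
    (groupClosedP S).

Local Open Scope classical_set_scope.

Definition finite_index (H K : {pred G}) : Prop :=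
  {subset H <= K} /\
  finite_set [set [set (k * h)%g | h in [set` H]] | k in [set` K]].

Definition commensurable (H K : {pred G}) : Prop :=
  finite_index [predI H & K] H /\ finite_index [predI H & K] K.

End Subgroups.

(* Group cohomology H^n(G, K) with trivial coefficients K, computed by the    *)
(* homogeneous standard complex                                               *)
(*   C^n = {f : G^(n+1) -> K | f (h g_0, ..., h g_n) = f (g_0, ..., g_n)},    *)
(*   (d f) (g_0, ..., g_(n+1)) = \sum_i (-1)^i f (g_0, .., ^g_i, .., g_(n+1)).*)
Section GroupCohomology.
Variable K : fieldType.

Section Def.
Variable G : groupType.

Definition cochain n : Type := ('I_n.+1 -> G) -> K^o.
HB.instance Definition _ n := GRing.Lmodule.copy (cochain n)
  (('I_n.+1 -> G) -> K^o).

Definition invariant n (f : cochain n) : Prop :=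
  forall (h : G) (g : 'I_n.+1 -> G), f (fun j => (h * g j)%g) = f g.

Definition differential n (f : cochain n) : cochain n.+1 :=
  fun g => \sum_(i < n.+2) (-1) ^+ i * f (fun j => g (lift i j)).

Definition is_coboundary n : cochain n -> Prop :=
  match n with
  | 0 => fun f => f = 0
  | m.+1 => fun f => exists2 h : cochain m, invariant h & f = differential h
  end.

Definition cocycle_pred n : {pred cochain n} :=
  fun f => `[< invariant f /\ differential f = 0 >].

Lemma differential_linear n (a : K) (f g : cochain n) :
  differential (a *: f + g) = a *: differential f + differential g.
Proof.
apply/funext => x; rewrite /differential !fctE /= /GRing.scale /=.
rewrite mulr_sumr -big_split /=; apply: eq_bigr => i _.
by rewrite mulrDr mulrCA.
Qed.

Lemma invariant_linear n (a : K) (f g : cochain n) :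
  invariant f -> invariant g -> invariant (a *: f + g).
Proof. by move=> If Ig h x; rewrite !fctE If Ig. Qed.

Lemma differential0 n : differential (0 : cochain n) = 0.
Proof.
by apply/funext => x; rewrite /differential big1 // => i _; rewrite mulr0.
Qed.

Lemma cocycle_submod n : submod_closed (@cocycle_pred n).
Proof.
split=> [|a f g /asboolP[If df] /asboolP[Ig dg]]; apply/asboolP; split=> //.
- exact: differential0.
- exact: invariant_linear.
- by rewrite differential_linear df dg scaler0 addr0.
Qed.

HB.instance Definition _ n :=
  GRing.isSubmodClosed.Build K (cochain n) (@cocycle_pred n)
    (@cocycle_submod n).

Definition cocycle n := {f : cochain n | f \in @cocycle_pred n}.
HB.instance Definition _ n :=
  SubChoice.copy (cocycle n) {f : cochain n | f \in @cocycle_pred n}.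
HB.instance Definition _ n := [SubChoice_isSubLmodule of cocycle n by <:].

Definition coboundary_pred n : {pred cocycle n} :=
  fun z => `[< is_coboundary (val z) >].

Lemma coboundary_submod n : submod_closed (@coboundary_pred n).
Proof.
split=> [|a y z /asboolP By /asboolP Bz]; apply/asboolP; rewrite ?linearP /=.
  case: n => [|n] //=; exists 0; last by rewrite differential0.
  by move=> h g.
case: n y z By Bz => [|n] y z /=; first by move=> -> ->; rewrite scaler0 addr0.
move=> [f If ->] [g Ig ->]; exists (a *: f + g).
  exact: invariant_linear.
by rewrite differential_linear.
Qed.

HB.instance Definition _ n :=
  GRing.isSubmodClosed.Build K (cocycle n) (@coboundary_pred n)
    (@coboundary_submod n).

Definition cohomology n := Quotient.quot (@coboundary_pred n).
HB.instance Definition _ n := GRing.Zmodule.on (cohomology n).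

Definition coh_class n (z : cocycle n) : cohomology n := \pi_(cohomology n)%qT z.

Lemma coh_classP n (y z : cocycle n) :
  coh_class y = coh_class z <-> y - z \in @coboundary_pred n.
Proof. by rewrite Quotient.idealrBE; split=> /eqP. Qed.

Lemma coh_class_repr n (x : cohomology n) : coh_class (generic_quotient.repr x) = x.
Proof. exact: reprK. Qed.

Lemma coh_class_is_zmod_morphism n : zmod_morphism (@coh_class n).
Proof. by move=> y z; rewrite /coh_class raddfB. Qed.
HB.instance Definition _ n :=
  GRing.isZmodMorphism.Build (cocycle n) (cohomology n) (@coh_class n)
    (@coh_class_is_zmod_morphism n).

Definition coh_scale n (a : K) (x : cohomology n) : cohomology n :=
  coh_class (a *: generic_quotient.repr x).

Lemma coh_scale_class n a (z : cocycle n) :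
  coh_scale a (coh_class z) = coh_class (a *: z).
Proof.
apply/coh_classP; rewrite -scalerBr rpredZ //.
by apply/coh_classP; rewrite coh_class_repr.
Qed.

Lemma coh_scaleA n a b (x : cohomology n) :
  coh_scale a (coh_scale b x) = coh_scale (a * b) x.
Proof. by rewrite -[x]coh_class_repr !coh_scale_class scalerA. Qed.

Lemma coh_scale1 n : left_id 1 (@coh_scale n).
Proof. by move=> x; rewrite -[x]coh_class_repr coh_scale_class scale1r. Qed.

Lemma coh_scaleDr n : right_distributive (@coh_scale n) +%R.
Proof.
move=> a x y; rewrite -[x]coh_class_repr -[y]coh_class_repr.
by rewrite -raddfD !coh_scale_class scalerDr raddfD.
Qed.

Lemma coh_scaleDl n (x : cohomology n) : {morph (@coh_scale n)^~ x : a b / a + b}.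
Proof.
move=> a b; rewrite -[x]coh_class_repr !coh_scale_class.
by rewrite scalerDl raddfD.
Qed.

HB.instance Definition _ n :=
  GRing.Zmodule_isLmodule.Build K (cohomology n)
    (@coh_scaleA n) (@coh_scale1 n) (@coh_scaleDr n) (@coh_scaleDl n).

Lemma coh_class_is_scalable n : scalable (@coh_class n).
Proof. by move=> a z; rewrite -coh_scale_class. Qed.
HB.instance Definition _ n :=
  GRing.isScalable.Build K (cocycle n) (cohomology n) *:%R (@coh_class n)
    (@coh_class_is_scalable n).

End Def.

(* Functoriality: phi : G -> H induces phi^* : H^n(H, K) -> H^n(G, K).        *)
Section Pullback.
Variables (G H : groupType) (phi : {multiplicative G -> H}).

Definition cochain_pullback n (f : cochain H n) : cochain G n :=
  fun g => f (fun j => phi (g j)).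

Lemma invariant_pullback n (f : cochain H n) :
  invariant f -> invariant (cochain_pullback f).
Proof.
move=> If h g; rewrite /cochain_pullback -[RHS](If (phi h)).
by congr (f _); apply/funext => j; rewrite gmulfM.
Qed.

Lemma is_coboundary_pullback n (f : cochain H n) :
  is_coboundary f -> is_coboundary (cochain_pullback f).
Proof.
case: n f => [|n] f /=; first by move=> ->; apply/funext.
by move=> [h Ih ->]; exists (cochain_pullback h); first exact: invariant_pullback.
Qed.

Lemma cocycle_pullback_subproof n (z : cocycle H n) :
  cochain_pullback (val z) \in @cocycle_pred G n.
Proof.
have /asboolP[Iz dz] := valP z; apply/asboolP; split.
  exact: invariant_pullback.
apply/funext => g; exact: (congr1 (fun f => f (fun j => phi (g j))) dz).
Qed.

Definition cocycle_pullback n (z : cocycle H n) : cocycle G n :=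
  Sub (cochain_pullback (val z)) (cocycle_pullback_subproof z).

Lemma cocycle_pullback_is_linear n : linear (@cocycle_pullback n).
Proof. by move=> a y z; apply: val_inj. Qed.
HB.instance Definition _ n :=
  GRing.isLinear.Build K (cocycle H n) (cocycle G n) *:%R (@cocycle_pullback n)
    (@cocycle_pullback_is_linear n).

Definition coh_pullback n (x : cohomology H n) : cohomology G n :=
  coh_class (cocycle_pullback (generic_quotient.repr x)).

Lemma coh_pullback_class n (z : cocycle H n) :
  coh_pullback (coh_class z) = coh_class (cocycle_pullback z).
Proof.
apply/coh_classP; rewrite -linearB; apply/asboolP/is_coboundary_pullback.
by apply/asboolP; apply/coh_classP; rewrite coh_class_repr.
Qed.

Lemma coh_pullback_is_linear n : linear (@coh_pullback n).
Proof.
move=> a x y; rewrite -[x]coh_class_repr -[y]coh_class_repr.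
by rewrite -linearP !coh_pullback_class -linearP -linearP.
Qed.
HB.instance Definition _ n :=
  GRing.isLinear.Build K (cohomology H n) (cohomology G n) *:%R (@coh_pullback n)
    (@coh_pullback_is_linear n).

End Pullback.
End GroupCohomology.

(* The representation theta occurs in the (possibly infinite-dimensional)     *)
(* G-module V with multiplicity at least B: V contains B subrepresentations   *)
(* isomorphic to theta (the images of the injective equivariant maps j i)     *)
(* whose sum is direct. As for mx_representation, elements of G act on V from *)
(* the right: act (s * t) = act t \o act s.                                   *)
Definition multiplicity_at_least (K : fieldType) (gT : finGroupType)
    (G : {group gT}) (m : nat) (theta : mx_representation K G m)
    (V : lmodType K) (act : gT -> V -> V) (B : nat) : Prop :=
  exists j : 'I_B -> {linear 'rV[K]_m -> V},
    (forall i s (v : 'rV[K]_m), s \in G ->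
       j i (v *m theta s) = act s (j i v)) /\
    (forall v : 'I_B -> 'rV[K]_m, \sum_i j i (v i) = 0 -> forall i, v i = 0).

Section GaloisAction.
Variable F : splittingFieldType rat.
Implicit Types s t : gal_of {:F}.

Lemma mem_gal1 s : s \in 'Gal({:F} / 1)%g.
Proof. by rewrite gal_kHom ?sub1v // k1HomE ahomWin. Qed.

Lemma gal_SL_subproof n s (A : SL n F) : \det (map_mx s A) == 1.
Proof. by rewrite det_map_mx SL_det rmorph1. Qed.

Definition gal_SL n s (A : SL n F) : SL n F := MkSL (gal_SL_subproof s A).

Lemma gal_SL_is_multiplicative n s :
  {morph @gal_SL n s : A B / (A * B)%g}.
Proof. by move=> A B; apply: val_inj; rewrite /= map_mxM. Qed.

Definition gal_stable n (S : {pred SL n F}) : Prop :=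
  forall s, s \in 'Gal({:F} / 1)%g -> forall A, A \in S -> gal_SL s A \in S.

Definition SL_integers n : {pred SL n F} :=
  fun A => `[< forall i j, integralOver (intr : int -> F) (A i j) >].

Definition arithmetic_subgroup n (S : groupClosed (SL n F)) : Prop :=
  commensurable S (@SL_integers n).

Definition totally_real (R : realType) : Prop :=
  forall (iota : {rmorphism F -> R[i]}) (x : F), iota x \is Num.real.

Section StableSubgroup.
Variables (n : nat) (S : groupClosed (SL n F)) (stableS : gal_stable S).

Lemma gal_subgroup_subproof s (A : subgroup_type S) : gal_SL s (val A) \in S.
Proof. exact: stableS (mem_gal1 s) _ (valP A). Qed.

Definition gal_subgroup s (A : subgroup_type S) : subgroup_type S :=
  Sub (gal_SL s (val A)) (gal_subgroup_subproof s A).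

Lemma gal_subgroup_is_multiplicative s :
  {morph gal_subgroup s : A B / (A * B)%g}.
Proof.
by move=> A B; apply: val_inj; rewrite /= -gal_SL_is_multiplicative.
Qed.
HB.instance Definition _ s :=
  isMultiplicative.Build (subgroup_type S) (subgroup_type S)
    (gal_subgroup s) (gal_subgroup_is_multiplicative s).

(* An automorphism s acts on a cochain f by f |-> f \o s^-1. MathComp's       *)
(* product in gal_of is (s * t) x = t (s x), the opposite of composition, so  *)
(* that this is a right action for it, in agreement with mx_representation.   *)
Definition gal_coh (K : fieldType) k s :
    cohomology K (subgroup_type S) k -> cohomology K (subgroup_type S) k :=
  @coh_pullback K _ _ (gal_subgroup s^-1%g) k.

Lemma gal_coh_linear (K : fieldType) k s : linear (@gal_coh K k s).
Proof. exact: coh_pullback_is_linear. Qed.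

Lemma gal_coh1 (K : fieldType) k x : @gal_coh K k 1%g x = x.
Proof.
rewrite -[x]coh_class_repr /gal_coh coh_pullback_class; congr coh_class.
case: (generic_quotient.repr x) => f Zf; apply/val_inj/funext => g.
apply: (congr1 f); apply/funext => j.
by do 2!apply: val_inj; apply/matrixP => a b; rewrite !mxE invg1 gal_id.
Qed.

Lemma gal_cohM (K : fieldType) k s t x :
  @gal_coh K k (s * t)%g x = gal_coh t (gal_coh s x).
Proof.
rewrite -[x]coh_class_repr /gal_coh coh_pullback_class.
rewrite (coh_pullback_class (gal_subgroup s^-1%g)) coh_pullback_class.
congr coh_class.
case: (generic_quotient.repr x) => f Zf; apply/val_inj/funext => g.
apply: (congr1 f); apply/funext => j.
do 2!apply: val_inj; apply/matrixP => a b.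
by rewrite !mxE invMg galM ?memvf.
Qed.

End StableSubgroup.
End GaloisAction.

(* Main.v *)
Require Import Defs.
From HB Require Import structures.
From mathcomp Require Import all_boot all_order all_algebra all_fingroup.
From mathcomp Require Import all_solvable all_field all_character.
From mathcomp Require Import boolp classical_sets functions cardinality fsbigop.
From mathcomp Require Import reals complex finmap.
From mathcomp Require Import zify ring lra.

(** Write [d] for the degree of [F], [G] for its Galois group and [O] for its
    integers, and let [SL_2(F)] act on the product of [d] upper half planes,
    one for each embedding of [F] in the reals. Two distinct cusps [a], [b] in
    [O] span a flat: the product over the embeddings [s] of the geodesics from
    [s a] to [s b]. Counting with signs how a [d]-simplex crosses the
    [Gamma0]-translates of that flat gives a [d]-cocycle of [Gamma0], the
    Poincare dual of a modular symbol. In each factor a geodesic has two sides,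
    and the crossing number is the cup product of the coboundaries of the [d]
    side functions, hence a cocycle ([crossing_cocycle]). Only finitely many
    translates meet a given simplex: a translate is an integral matrix of rank
    one, and a matrix whose geodesics all meet a compact set has bounded
    conjugates ([finite_crossing]).

    The cocycles are told apart by tori. At a cusp [c], elements
    [u_1, ..., u_d] of [F] whose unipotents lie in [Gamma0] span a torus of
    dimension [d]; the value of a cocycle on its fundamental cycle is an
    alternating sum over the permutations of the [u_j], and it kills
    coboundaries ([torus_eval_coboundary]). The value does not change when the
    torus is pushed up into the cusp ([alt_sum_raise]), and a torus high up
    does not meet the translates that do not end at [c]: the heights to which
    such a translate rises in the [d] factors have a product inversely
    proportional to a norm, and nonzero integers have norm at least 1
    ([raised_crossing_eq0]). So the value is 0 unless some translate of the
    flat ends at [c] ([flat_undetected]). At [c = a] the value is nonzero for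
    suitable [u_j] ([flat_detected]). Indeed let [u_j] be close to [4 * rho * n]
    times the [j]-th coordinate vector, with [rho] fixed and [n] large. The
    value is then an alternating sum over permutations of numbers of lattice
    points in boxes; the box of the identity contains at least [n ^ d] points
    ([count_main_ge]), all counted with one sign, whereas the others are thin
    and contain [O(n ^ (d - 1))] points ([off_diagonal_bound]), because two
    integers in a box of volume less than 1 are equal ([size_box]).

    For [Gamma0] take the elements of [Gamma] congruent to 1 modulo some [n]. They
    preserve the residue of a cusp modulo [n], so once all conjugates of the
    cusps [a_k], [b_k] ([k < B]) are distinct modulo [n], the torus at
    [t a_l] sees the translate by [s] of the [k]-th class exactly when
    [(s, k) = (t, l)]. The classes of the flats from [a_k] to [b_k] and their
    Galois translates are thus linearly independent, and they span [B] copies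
    of the regular representation of [G]. Matrix coefficients embed each
    irreducible representation in each copy ([coefficient_map],
    [irreducible_functional]). *)

Set Implicit Arguments.
Unset Strict Implicit.
Unset Printing Implicit Defensive.

Import Order.TTheory GRing.Theory Num.Theory.
Local Open Scope ring_scope.

(** * Alternating sums over flags of subsets *)

Section Antisymmetrization.
Variable K : numDomainType.

Definition prefix_set N (p : 'S_N) (k : nat) : {set 'I_N} :=
  [set p l | l in 'I_N & (l < k)%N].

(** A point for every subset of the steps, rather than a product of group
    elements, encodes that the steps commute. *)
Definition flag_path N (X : Type) (pt : {set 'I_N} -> X) (p : 'S_N) :
    'I_N.+1 -> X := fun k => pt (prefix_set p k).

Lemma mem_prefix_set N (p : 'S_N) k x :
  (x \in prefix_set p k) = (p^-1%g x < k)%N.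
Proof.
apply/imsetP/idP => [[l]|lt_k]; first by rewrite inE => + ->; rewrite permK.
by exists (p^-1%g x); rewrite ?permKV // inE.
Qed.

(** When [pt B] is the product of the commuting elements indexed by [B], this is
    the value of [h] on the fundamental cycle of the torus that they span. *)
Definition alt_sum N (X : Type) (h : ('I_N.+1 -> X) -> K)
    (pt : {set 'I_N} -> X) : K :=
  \sum_(p : 'S_N) (-1) ^+ p * h (flag_path pt p).

Lemma prefix_set_tperm N (p : 'S_N.+1) (k : 'I_N) m : m != k.+1 ->
  prefix_set (tperm (inord k) (inord k.+1) * p)%g m = prefix_set p m.
Proof.
move=> m_k; apply/setP => x; rewrite !mem_prefix_set invMg permM tpermV.
set y := (p^-1)%g x.
have kE : @inord N k = k :> nat by rewrite inordK // ltnW // ltnS.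
have k1E : @inord N k.+1 = k.+1 :> nat by rewrite inordK // ltnS.
by case: tpermP => [->|->|//]; rewrite kE k1E; apply/idP/idP; lia.
Qed.

(** Summands that agree on [p] and on its product with a transposition come with
    opposite signs. *)
Lemma sum_sign_eq0 N (E : 'S_N -> K) (i j : 'I_N) : i != j ->
  (forall p, E (tperm i j * p)%g = E p) -> \sum_(p : 'S_N) (-1) ^+ p * E p = 0.
Proof.
move=> ij Einv; set S := LHS; have: S + S == 0; last by rewrite -mulr2n mulrn_eq0 => /eqP.
rewrite {1}/S (reindex_inj (mulgI (tperm i j))) -big_split big1 //= => p _.
by rewrite Einv odd_permM odd_tperm ij signrN mulNr addNr.
Qed.

(** The interior faces cancel: dropping the [k]-th vertex of a flag
    forgets the order of the two steps around it. *)
Lemma alt_sum_faces n (X : Type) (h : ('I_n.+1 -> X) -> K)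
    (pt : {set 'I_n.+1} -> X) :
  alt_sum (fun x => \sum_(k < n.+2) (-1) ^+ k * h (x \o lift k)) pt =
  \sum_(p : 'S_n.+1) (-1) ^+ p *
    (h (flag_path pt p \o lift ord0) +
     (-1) ^+ n.+1 * h (flag_path pt p \o lift ord_max)).
Proof.
transitivity (\sum_(k < n.+2) \sum_(p : 'S_n.+1)
    (-1) ^+ p * ((-1) ^+ k * h (flag_path pt p \o lift k))).
  by rewrite exchange_big; apply: eq_bigr => p _; rewrite mulr_sumr.
rewrite big_ord_recl big_ord_recr /= [X in _ + (X + _)]big1 ?add0r; last first.
  move=> k _; apply: (@sum_sign_eq0 _ _ (inord k) (inord k.+1)) => [|p].
    by rewrite -val_eqE /= !inordK ?ltnS // 1?ltnW ?neq_ltn ?leqnn // ltnS.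
  congr (_ * h _); apply/funext => j; congr pt; apply: prefix_set_tperm.
  by rewrite eq_sym; apply: neq_lift (lift ord0 (widen_ord _ k)) j.
rewrite -big_split; apply: eq_bigr => p _ /=; rewrite expr0 mul1r -mulrDr; congr (_ * (h _ + _)).
Qed.

(** Moving the first step of a flag to its end is a cyclic permutation of sign
    [(-1) ^+ n], and it turns the first face into a translate of the last one.
    The steps in [P] are those under which [h] is invariant. *)
Lemma flag_path_rotate n (X : Type) (h : ('I_n.+1 -> X) -> K)
    (pt : {set 'I_n.+1} -> X) (P : pred 'I_n.+1) :
  (forall j (A : 'I_n.+1 -> {set 'I_n.+1}), P j -> (forall k, j \notin A k) ->
    h (fun k => pt (j |: A k)) = h (pt \o A)) ->
  \sum_(p : 'S_n.+1 | P (p ord0)) (-1) ^+ p * h (flag_path pt p \o lift ord0) +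
  \sum_(p : 'S_n.+1 | P (p ord_max)) (-1) ^+ p *
    ((-1) ^+ n.+1 * h (flag_path pt p \o lift ord_max)) = 0.
Proof.
move=> hP; pose c : 'S_n.+1 := lift_perm ord_max ord0 1.
rewrite addrC (reindex_inj (mulgI c)) /=.
under eq_bigl do rewrite permM lift_perm_id.
rewrite -big_split big1 //= => p Pp0.
have cK : forall x, (c^-1 (p^-1 x))%g = ((c * p)^-1%g x) by move=> x; rewrite invMg permM.
have p0_notin (k : 'I_n.+1) : p ord0 \notin prefix_set (c * p)%g k.
  rewrite mem_prefix_set -cK permK -leqNgt.
  by rewrite -[X in (c^-1%g X)](lift_perm_id ord_max ord0 1) permK -ltnS.
have <- : h (flag_path pt p \o lift ord0) = h (flag_path pt (c * p)%g \o lift ord_max).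
  rewrite [RHS](_ : _ = h (pt \o fun k : 'I_n.+1 => prefix_set (c * p)%g k)); last first.
    by congr h; apply/funext => k; congr (pt (prefix_set _ _)); apply: lift_max.
  rewrite -(hP _ _ Pp0 p0_notin); congr h; apply/funext => k; congr pt.
  apply/setP => x; rewrite !inE !mem_prefix_set -cK /= /bump leq0n.
  rewrite -(can_eq (permK p^-1%g)) permK.
  case: (unliftP ord0 (p^-1%g x)) => [z ->|->]; last by rewrite eqxx.
  rewrite eq_sym (negPf (neq_lift _ _)) /=.
  have -> : (c^-1%g (lift ord0 z)) = lift ord_max z.
    by apply: (canLR (permK c)); rewrite lift_perm_lift perm1.
  by rewrite lift_max.
rewrite odd_permM odd_lift_perm odd_perm1 addbF /= addbF signr_addb signr_odd.
rewrite mulrA -mulrDl exprS mulN1r mulrN mulrAC -expr2 sqrr_sign mul1r.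
by rewrite addNr mul0r.
Qed.

(** A torus is a cycle: all steps leave [h] invariant, so opposite faces cancel. *)
Lemma alt_sum_coboundary n (X : Type) (h : ('I_n.+1 -> X) -> K)
    (pt : {set 'I_n.+1} -> X) :
  (forall j (A : 'I_n.+1 -> {set 'I_n.+1}), (forall k, j \notin A k) ->
    h (fun k => pt (j |: A k)) = h (pt \o A)) ->
  alt_sum (fun x => \sum_(k < n.+2) (-1) ^+ k * h (x \o lift k)) pt = 0.
Proof.
move=> hpt; rewrite alt_sum_faces.
under eq_bigr do rewrite mulrDr.
rewrite big_split /=.
by apply: (@flag_path_rotate _ _ _ _ predT) => j A _; apply: hpt.
Qed.

Lemma big_lift_perm n (i j : 'I_n.+1) (E : 'S_n.+1 -> K) :
  \sum_(p : 'S_n.+1 | p i == j) E p = \sum_(s : 'S_n) E (lift_perm i j s).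
Proof.
pose f (p : 'S_n.+1) k := odflt k (unlift j (p (lift i k))).
have fK (p : 'S_n.+1) k : p i == j -> lift j (f p k) = p (lift i k).
  rewrite /f => /eqP <-; have := neq_lift i k.
  by rewrite -(inj_eq (@perm_inj _ p)) => /unlift_some[m -> ->].
have f_inj (p : 'S_n.+1) : injective (if p i == j then f p else id).
  case: ifPn => pij k k' eqf //; have := fK p k pij.
  by rewrite eqf fK // => /perm_inj/lift_inj.
rewrite (reindex (lift_perm i j)); last first.
  exists (fun p => perm (@f_inj p)) => [s _|p]; last rewrite inE => pij.
    by apply/permP => k; rewrite permE lift_perm_id eqxx /f lift_perm_lift liftK.
  apply/permP => k; case: (unliftP i k) => [m|] ->.
    by rewrite lift_perm_lift permE pij fK.
  by rewrite lift_perm_id; apply/esym/eqP.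
by apply: eq_bigl => s; rewrite lift_perm_id eqxx.
Qed.

Lemma lift_imset_prefix n (i j : 'I_n.+1) (s : 'S_n) (k : nat) x :
  (x \in lift j @: prefix_set s k) =
  (if unlift i ((lift_perm i j s)^-1%g x) is Some m then (m < k)%N else false).
Proof.
case: (unliftP j x) => [y|] ->.
  rewrite mem_imset ?mem_prefix_set; last exact: lift_inj.
  have -> : ((lift_perm i j s)^-1%g (lift j y)) = lift i (s^-1%g y).
    by apply: (canLR (permK _)); rewrite lift_perm_lift permKV.
  by rewrite liftK.
have -> : ((lift_perm i j s)^-1%g j) = i.
  by apply: (canLR (permK _)); rewrite lift_perm_id.
rewrite unlift_none; apply/imsetP => -[y _ /eqP]; apply/negP.
exact: neq_lift.
Qed.

(** Homotopy invariance of the value on a torus. The last step moves the torus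
    without leaving [h] invariant; the other pairs of opposite faces of the prism
    that it sweeps cancel, which leaves the two ends. *)
Lemma alt_sum_shift n (X : Type) (h : ('I_n.+1 -> X) -> K)
    (pt : {set 'I_n.+1} -> X) :
  (forall p, \sum_(k < n.+2) (-1) ^+ k * h (flag_path pt p \o lift k) = 0) ->
  (forall j (A : 'I_n.+1 -> {set 'I_n.+1}), j != ord_max ->
    (forall k, j \notin A k) -> h (fun k => pt (j |: A k)) = h (pt \o A)) ->
  alt_sum h (fun A : {set 'I_n} => pt (ord_max |: lift ord_max @: A)) =
  alt_sum h (fun A : {set 'I_n} => pt (lift ord_max @: A)).
Proof.
move=> dh hpt; have := alt_sum_faces h pt.
rewrite {1}/alt_sum big1 => [|p _]; last by rewrite dh mulr0.
under eq_bigr do rewrite mulrDr.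
rewrite big_split /= (bigID (fun p : 'S_n.+1 => p ord0 != ord_max)) /=.
rewrite [X in _ = _ + X](bigID (fun p : 'S_n.+1 => p ord_max != ord_max)) /=.
rewrite addrACA (@flag_path_rotate _ _ _ _ (predC1 ord_max)) ?add0r => [|j A]; last exact: hpt.
under eq_bigl do rewrite negbK; under [X in _ = _ + X]eq_bigl do rewrite negbK.
rewrite !big_lift_perm => /esym/eqP; rewrite addr_eq0 -sumrN => /eqP sumE.
have sn0 : (-1) ^+ n != 0 :> K by rewrite signr_eq0.
apply: (mulfI sn0); rewrite !mulr_sumr.
have face0 s : flag_path pt (lift_perm ord0 ord_max s) \o lift ord0 =
    flag_path (fun A : {set 'I_n} => pt (ord_max |: lift ord_max @: A)) s.
  apply/funext => k; congr pt; apply/setP => x.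
  rewrite !inE (lift_imset_prefix ord0) mem_prefix_set /=.
  rewrite -(inj_eq (@perm_inj _ (lift_perm ord0 ord_max s)^-1%g) x).
  have -> : ((lift_perm ord0 ord_max s)^-1%g ord_max) = ord0.
    by apply: (canLR (permK _)); rewrite lift_perm_id.
  case: unliftP => [m ->|->]; last by rewrite eqxx.
  by rewrite eq_sym (negPf (neq_lift _ _)) /= /bump !leq0n.
have facemax s : flag_path pt (lift_perm ord_max ord_max s) \o lift ord_max =
    flag_path (fun A : {set 'I_n} => pt (lift ord_max @: A)) s.
  apply/funext => k; congr pt; apply/setP => x.
  rewrite (lift_imset_prefix ord_max) mem_prefix_set.
  have -> : lift ord_max k = k :> nat by exact: lift_max.
  by case: unliftP => [m ->|->]; rewrite ?lift_max // ltnNge -ltnS ltn_ord.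
transitivity (\sum_(s : 'S_n) (-1) ^+ lift_perm ord0 ord_max s *
    h (flag_path pt (lift_perm ord0 ord_max s) \o lift ord0)).
  apply: eq_bigr => s _.
  by rewrite face0 odd_lift_perm /= signr_addb signr_odd mulrA.
rewrite sumE; apply: eq_bigr => s _.
by rewrite facemax odd_lift_perm addbb addFb exprS mulN1r mulNr mulrN opprK mulrCA.
Qed.
End Antisymmetrization.

(** * Products of coboundaries *)

Section Crossing.
Variables (K : comPzRingType) (d : nat) (X : Type).
Implicit Types (chi : 'I_d -> X -> K).

(** The cup product of the coboundaries of the functions [chi i]. *)
Definition crossing chi (x : 'I_d.+1 -> X) : K :=
  \prod_(i < d) (chi i (x (lift ord0 i)) - chi i (x (lift ord_max i))).

Lemma crossing_cocycle chi (x : 'I_d.+2 -> X) :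
  \sum_(k < d.+2) (-1) ^+ k * crossing chi (x \o lift k) = 0.
Proof.
pose a (i : 'I_d) n := chi i (x (inord n)).
(* The [k]-th face is [P k.-1 + P k], without the first or second summand for
   the two outer faces, so that the alternating sum telescopes. *)
pose P k := \prod_(i < d) (if (i < k)%N then a i i.+1 - a i i
                            else a i i.+2 - a i i.+1).
have faceE (k : 'I_d.+2) : crossing chi (x \o lift k) =
    \prod_(i < d) (a i (bump k i.+1) - a i (bump k i)).
  apply: eq_bigr => i _; have lti := ltn_ord i.
  congr (chi i (x _) - chi i (x _)).
    by apply: val_inj; rewrite /= inordK /bump; lia.
  apply: val_inj; rewrite /= -[bump d i]/(nat_of_ord (lift ord_max i)) lift_max.
  by rewrite inordK // /bump; lia.
have {faceE} faceE (k : 'I_d.+2) : crossing chi (x \o lift k) =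
    (if (0 < k)%N then P k.-1 else 0) + (if (k <= d)%N then P k else 0).
  rewrite faceE; case: k => -[|k] ltk /=.
    by rewrite add0r; apply: eq_bigr => i _; rewrite /bump.
  case: ltnP => kd; last first.
    rewrite addr0; apply: eq_bigr => i _; have lti := ltn_ord i.
    have [-> -> ->] : [/\ bump k.+1 i.+1 = i.+1, bump k.+1 i = i & (i < k)%N].
      by rewrite /bump; split; lia.
    by [].
  have otherE (l : nat) (i : 'I_d) : l = k \/ l = k.+1 -> i != Ordinal kd ->
      (if (i < l)%N then a i i.+1 - a i i else a i i.+2 - a i i.+1) =
      a i (bump k.+1 i.+1) - a i (bump k.+1 i).
    rewrite -val_eqE /= /bump => lk ik; have [ltik|leki] := ltnP i k.
      have -> : (i < l)%N by lia.
      by congr (a i _ - a i _); lia.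
    have -> : (i < l)%N = false by lia.
    by congr (a i _ - a i _); lia.
  rewrite /P (bigD1 (Ordinal kd)) //= [X in _ = X + _](bigD1 (Ordinal kd)) //=.
  rewrite [X in _ = _ + X](bigD1 (Ordinal kd)) //= ltnn ltnSn.
  rewrite (eq_bigr _ (fun i => otherE k i (or_introl erefl))).
  rewrite [X in _ = _ + _ * X](eq_bigr _ (fun i => otherE k.+1 i (or_intror erefl))).
  have [-> ->] : bump k.+1 k.+1 = k.+2 /\ bump k.+1 k = k by rewrite /bump; lia.
  by rewrite -mulrDl subrKA.
under eq_bigr do rewrite faceE mulrDr.
rewrite big_split /= big_ord_recl /= mulr0 add0r.
rewrite [X in _ + X]big_ord_recr /= ltnn mulr0 addr0 -big_split big1 //= => i _.
by rewrite -ltnS ltn_ord /bump /= add1n exprS mulN1r mulNr addNr.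
Qed.
End Crossing.

(** * Binary quadratic forms and geodesics *)

Section TwoByTwo.
Variable T : comPzRingType.

Lemma ord2 (i : 'I_2) : (i == 0) || (i == 1).
Proof. by case: i => -[|[|]]. Qed.

Lemma lift0_ord2 : lift ord0 ord0 = 1 :> 'I_2.
Proof. exact: val_inj. Qed.

Lemma mulmx2 m n (A : 'M[T]_(m, 2)) (B : 'M_(2, n)) i j :
  (A *m B) i j = A i 0 * B 0 j + A i 1 * B 1 j.
Proof. by rewrite mxE !big_ord_recl big_ord0 addr0 lift0_ord2. Qed.

Lemma mxtrace2 (M : 'M[T]_2) : \tr M = M 0 0 + M 1 1.
Proof. by rewrite /mxtrace !big_ord_recl big_ord0 addr0 lift0_ord2. Qed.

Lemma mxtrace_mul2 (M S : 'M[T]_2) :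
  \tr (M *m S) = M 0 0 * S 0 0 + M 0 1 * S 1 0 + M 1 0 * S 0 1 + M 1 1 * S 1 1.
Proof. by rewrite mxtrace2 !mulmx2 !addrA. Qed.

Lemma det_mx2 (A : 'M[T]_2) : \det A = A 0 0 * A 1 1 - A 0 1 * A 1 0.
Proof.
rewrite (expand_det_row _ 0) !big_ord_recl big_ord0 /cofactor !det_mx11 !mxE /=.
rewrite lift0_ord2; have -> : lift 1 ord0 = 0 :> 'I_2 by exact: val_inj.
by rewrite expr0 expr1 mul1r mulN1r mulrN addr0.
Qed.
End TwoByTwo.

Section Forms.
Variable R : realFieldType.
Implicit Types (S M : 'M[R]_2) (C : R).

(** A positive definite form, with a bound [C] on its size and on that of its
    inverse; stated so that it is preserved by convex combinations. Points of the
    upper half plane are such forms, up to scaling: [g] moves the base point to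
    [g *m g^T]. *)
Definition sym_bounded C S : Prop :=
  [/\ 1 <= C, S 0 1 = S 1 0, S 0 0 <= C, S 1 1 <= C &
    forall x y, x ^+ 2 + y ^+ 2 <=
      C * (S 0 0 * x ^+ 2 + (S 0 1 * (x * y)) *+ 2 + S 1 1 * y ^+ 2)].

(** For [M = b^T *m a], with linear forms [a] and [b], this is the sign of the
    inner product of [a] and [b] under [S]: it says on which side [S] lies of the
    geodesic that joins the zeros of [a] and [b]. *)
Definition side M S : bool := 0 < \tr (M *m S).

Lemma sym_bounded_convex C S S' t : 0 <= t <= 1 ->
  sym_bounded C S -> sym_bounded C S' ->
  sym_bounded C (t *: S + (1 - t) *: S').
Proof.
move=> /andP[t0 t1] [C1 S01 S00 S11 SP] [_ S'01 S'00 S'11 S'P].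
split; rewrite ?mxE //; first by rewrite S01 S'01.
- by nra.
- by nra.
move=> x y; have := SP x y; have := S'P x y; move: t0 t1.
set u := S 0 0 * _ + _ + _; set u' := S' 0 0 * _ + _ + _ => t0 t1 h' h.
rewrite [X in _ <= C * X](_ : _ = t * u + (1 - t) * u'); last by rewrite /u /u'; ring.
by nra.
Qed.

(** If [M] separates two points, the segment between them meets its geodesic. *)
Lemma side_separation C S S' M E : sym_bounded C S -> sym_bounded C S' ->
  side M (S + E) != side M (S' + E) ->
  exists2 T, sym_bounded C T & \tr (M *m (T + E)) = 0.
Proof.
wlog sideS : S S' / side M (S + E).
  move=> IH bS bS' neq; have /orP[hS|hS'] : side M (S + E) || side M (S' + E).
  - by move: neq; do 2!case: (side _ _).
  - exact: (IH S S').
  - by apply: (IH S' S); rewrite // eq_sym.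
rewrite sideS => bS bS'; rewrite eq_sym -negb_add addbT negbK.
move: sideS; rewrite /side -leNgt !mulmxDr !mxtraceD.
set p := \tr (M *m S); set p' := \tr (M *m S'); set e := \tr (M *m E) => h h'.
have pp' : 0 < p - p' by lra.
(* The trace is affine along the segment; this is its zero. *)
exists ((- (p' + e) / (p - p')) *: S + (1 - (- (p' + e) / (p - p'))) *: S').
  apply: sym_bounded_convex => //.
  by rewrite ler_pdivlMr // ler_pdivrMr // mul0r mul1r; lra.
rewrite !mulmxDr !mxtraceD -!scalemxAr !mxtraceZ -/p -/p' -/e.
by field; lra.
Qed.

Section RankOne.
Variables (a b : 'rV[R]_2).
Let M : 'M[R]_2 := b^T *m a.
Let k := M 1 0 - M 0 1.

Let ME i j : M i j = b 0 i * a 0 j.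
Proof. by rewrite mxE big_ord1 mxE. Qed.

(** On the geodesic the forms [a] and [b] are orthogonal, so the product of
    their squared lengths is [\det T * k ^+ 2]; the lengths bound the entries. *)
Lemma side_separation_bound C S S' : sym_bounded C S -> sym_bounded C S' ->
  side M S != side M S' -> forall i j, (M i j) ^+ 2 <= C ^+ 4 * k ^+ 2.
Proof.
move=> bS bS'; rewrite -[S]addr0 -[S']addr0 => /(side_separation bS bS')[T bT].
have [C1 T01 T00 T11 TP] := bT; rewrite addr0 mxtrace_mul2 !ME T01 => tr0 i j.
have := TP (a 0 0) (a 0 1); have := TP (b 0 0) (b 0 1); rewrite T01.
set u := _ + _ *+ 2 + _; set w := _ + _ *+ 2 + _ => hb ha.
have uw : u * w = (T 0 0 * T 1 1 - T 1 0 ^+ 2) * k ^+ 2.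
  rewrite -[RHS]add0r -[X in _ = X + _](expr0n R 2) -{}tr0 /u /w /k !ME; ring.
have T00_ge0 : 0 <= T 0 0 by have := TP 1 0; nra.
have T11_ge0 : 0 <= T 1 1 by have := TP 0 1; nra.
have ai : (a 0 j) ^+ 2 <= C * w by apply: le_trans ha; case/orP: (ord2 j) => /eqP->; nra.
have bi : (b 0 i) ^+ 2 <= C * u by apply: le_trans hb; case/orP: (ord2 i) => /eqP->; nra.
rewrite ME exprMn; apply: (@le_trans _ _ (C * u * (C * w))).
  by apply: ler_pM; rewrite ?sqr_ge0.
have -> : C * u * (C * w) = C ^+ 2 * (u * w) by ring.
rewrite uw (_ : C ^+ 4 = C ^+ 2 * C ^+ 2); last by ring.
rewrite -[X in _ <= X]mulrA ler_wpM2l ?sqr_ge0 // ler_wpM2r ?sqr_ge0 //.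
rewrite (le_trans (y := T 0 0 * T 1 1)) ?expr2 ?ler_pM //.
by rewrite lerBlDr lerDl -expr2 sqr_ge0.
Qed.

(** As [c] grows, the determinant of the raised forms grows like [c] only, but
    the product of the squared lengths of [a] and [b] like [c ^+ 2] times the
    squares of their values at [v]. *)
Lemma side_separation_raised C S S' (v : 'cV[R]_2) c :
  sym_bounded C S -> sym_bounded C S' -> 0 <= c ->
  side M (S + c *: (v *m v^T)) != side M (S' + c *: (v *m v^T)) ->
  (c * \tr (M *m (v *m v^T))) ^+ 2 <=
    k ^+ 2 * (C ^+ 2 + (c * C * (v 0 0 ^+ 2 + v 1 0 ^+ 2)) *+ 2).
Proof.
move=> bS bS' c_ge0 /(side_separation bS bS')[T [C1 T01 T00 T11 TP]].
have vvE i j : (v *m v^T) i j = v i 0 * v j 0 by rewrite mxE big_ord1 mxE.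
have cvvE i j : (c *: (v *m v^T)) i j = c * (v i 0 * v j 0) by rewrite mxE vvE.
rewrite !mxtrace_mul2 4![(T + _) _ _]mxE !cvvE !vvE !ME T01 => tr0.
have T00_ge0 : 0 <= T 0 0 by have := TP 1 0; nra.
have T11_ge0 : 0 <= T 1 1 by have := TP 0 1; nra.
have quad_ge0 x y : 0 <= T 0 0 * x ^+ 2 + (T 1 0 * (x * y)) *+ 2 + T 1 1 * y ^+ 2.
  rewrite -(@pmulr_rge0 _ C) ?(lt_le_trans ltr01) // -T01.
  by apply: le_trans (TP x y); rewrite addr_ge0 ?sqr_ge0.
pose q (z : 'rV[R]_2) := T 0 0 * z 0 0 ^+ 2 + (T 1 0 * (z 0 0 * z 0 1)) *+ 2 +
  T 1 1 * z 0 1 ^+ 2.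
pose l (z : 'rV[R]_2) := z 0 0 * v 0 0 + z 0 1 * v 1 0.
have qE : (q a + c * l a ^+ 2) * (q b + c * l b ^+ 2) = k ^+ 2 *
    (T 0 0 * T 1 1 - T 1 0 ^+ 2 + c * (T 0 0 * v 1 0 ^+ 2 + T 1 1 * v 0 0 ^+ 2
     - (T 1 0 * (v 0 0 * v 1 0)) *+ 2)).
  rewrite -[RHS]add0r -[X in _ = X + _](expr0n R 2) -{}tr0 /q /l /k !ME; ring.
apply: (@le_trans _ _ ((q a + c * l a ^+ 2) * (q b + c * l b ^+ 2))).
  have -> : (c * (b 0 0 * a 0 0 * (v 0 0 * v 0 0) + b 0 0 * a 0 1 * (v 1 0 * v 0 0) +
      b 0 1 * a 0 0 * (v 0 0 * v 1 0) + b 0 1 * a 0 1 * (v 1 0 * v 1 0))) ^+ 2 =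
      c * l a ^+ 2 * (c * l b ^+ 2) by rewrite /l; ring.
  have cl z : 0 <= c * l z ^+ 2 by rewrite mulr_ge0 ?sqr_ge0.
  by apply: ler_pM; rewrite ?cl // lerDr quad_ge0.
rewrite qE ler_wpM2l ?sqr_ge0 //; apply: lerD.
  rewrite (le_trans (y := T 0 0 * T 1 1)) ?[_ ^+ 2]expr2 ?ler_pM //.
  by rewrite lerBlDr lerDl -expr2 sqr_ge0.
rewrite -[leRHS]mulrnAr -[leRHS]mulrA ler_wpM2l //.
have := quad_ge0 (v 0 0) (v 1 0); have := sqr_ge0 (v 0 0); have := sqr_ge0 (v 1 0).
move: (v 0 0) (v 1 0) => x y.
have := quad_ge0 y (- x); nra.
Qed.
End RankOne.

Lemma sym_bounded_le C C' S : C <= C' -> sym_bounded C S -> sym_bounded C' S.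
Proof.
move=> CC' [C1 S01 S00 S11 SP]; split; rewrite ?(le_trans _ CC') // => x y.
apply: le_trans (SP x y) _; rewrite ler_wpM2r //.
rewrite -(@pmulr_rge0 _ C) ?(lt_le_trans ltr01) //.
by apply: le_trans (SP x y); rewrite addr_ge0 ?sqr_ge0.
Qed.

(** The inverse of a 2 by 2 matrix of determinant 1 has the same entries up to
    sign and order, so one constant bounds the form and its inverse. *)
Lemma sym_bounded_gram (A : 'M[R]_2) : \det A = 1 ->
  exists C, sym_bounded C (A *m A^T).
Proof.
rewrite det_mx2 => detA.
exists (1 + A 0 0 ^+ 2 + A 0 1 ^+ 2 + A 1 0 ^+ 2 + A 1 1 ^+ 2).
split; rewrite ?mulmx2 ?[A^T _ _]mxE; try by nra.
move=> x y; move: detA; move: (A 0 0) (A 0 1) (A 1 0) (A 1 1) => p q r s detA.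
pose z := p * x + r * y; pose w := q * x + s * y.
rewrite [X in _ <= _ * X](_ : _ = z ^+ 2 + w ^+ 2); last by rewrite /z /w; ring.
have -> : x = s * z - r * w by rewrite /z /w -[LHS]mul1r -detA; ring.
have -> : y = p * w - q * z by rewrite /z /w -[LHS]mul1r -detA; ring.
rewrite -subr_ge0 [X in 0 <= X](_ : _ = (z ^+ 2 + w ^+ 2) + (s * w + r * z) ^+ 2 +
  (p * z + q * w) ^+ 2); last by ring.
by rewrite !addr_ge0 ?sqr_ge0.
Qed.

End Forms.

(** * Integers with norms bounded below *)

Section DiscreteIntegers.
Local Open Scope classical_set_scope.
Local Open Scope ring_scope.
Variables (R : realType) (F : fieldType) (d : nat).
Variables (sigma : 'I_d -> {rmorphism F -> R}) (O : subringClosed F).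

(** With the embeddings of a number field this holds for its integers, as the
    norm of a nonzero integer is a nonzero rational integer. *)
Definition norm_bounded_below : Prop :=
  forall x, x \in O -> x != 0 -> 1 <= \prod_(i < d) `|sigma i x|.

Hypothesis norm_ge1 : norm_bounded_below.

(** Cut the box along the direction [i0] into slices of volume 1. The norm of a
    difference of two points of one slice is less than 1, so that slices contain
    at most one point. The factor 2 is lost because the slices are numbered
    from a point of [s], which may lie anywhere in the box. *)
Lemma size_box (i0 : 'I_d) (b : 'I_d -> R) (s : seq F) :
  (forall i, 0 < b i) -> uniq s -> {subset s <= O} ->
  (forall x y i, x \in s -> y \in s -> `|sigma i x - sigma i y| <= b i) ->
  (size s)%:R <= 2 * (\prod_(i < d) b i + 1).
Proof.
move=> b_gt0 s_uniq sO sb; set V := \prod_(i < d) b i.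
pose h := \prod_(i < d | i != i0) b i.
have h_gt0 : 0 < h by exact: prodr_gt0.
have V_ge0 : 0 <= V by apply: prodr_ge0 => i _; apply: ltW.
case: s s_uniq sO sb => [|x0 s0] s_uniq sO sb; first by rewrite mulr_ge0 ?addr_ge0.
set s := x0 :: s0 in s_uniq sO sb *; have x0s : x0 \in s by rewrite mem_head.
pose N := (Num.truncn V).+1.
have VN : V < N%:R by exact: truncnS_gt.
pose g x := Num.floor (h * (sigma i0 x - sigma i0 x0)).
have g_bound x : x \in s -> - (N%:Z) <= g x < N%:Z.
  move=> xs; have : `|h * (sigma i0 x - sigma i0 x0)| < N%:R.
    rewrite normrM gtr0_norm //; apply: le_lt_trans VN.
    by rewrite /V (bigD1 i0) //= mulrC; apply: ler_wpM2r (ltW h_gt0) _ _ _; apply: sb.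
  by rewrite ltr_norml /g floor_ge_int floor_lt_int rmorphN /= => /andP[/ltW -> ->].
have g_inj : {in s &, injective g}.
  move=> x y xs ys gxy; apply/eqP; rewrite -subr_eq0; apply/negPn/negP => xy0.
  have := norm_ge1 (rpredB (sO _ xs) (sO _ ys)) xy0; apply/negP; rewrite -ltNge.
  have lt1 : `|h * (sigma i0 x - sigma i0 y)| < 1.
    have /andP[xl xg] := floor_itv (h * (sigma i0 x - sigma i0 x0)).
    have /andP[yl yg] := floor_itv (h * (sigma i0 y - sigma i0 x0)).
    move: xl xg yl yg; rewrite -/(g x) -/(g y) gxy !intrD; move: (_%:~R) => t.
    by rewrite ltr_norml; move=> *; apply/andP; split; lra.
  rewrite (bigD1 i0) //= rmorphB; apply: le_lt_trans lt1.
  rewrite normrM gtr0_norm // mulrC; apply: ler_wpM2r => //.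
  by apply: ler_prod => i _; rewrite normr_ge0 rmorphB /= sb.
have : (size [seq absz (g x + N%:Z)%R | x <- s] <= size (iota 0 (N + N)))%N.
  apply: uniq_leq_size.
    rewrite map_inj_in_uniq // => x y xs ys; have := g_bound _ xs; have := g_bound _ ys.
    move=> yN xN eg; apply: g_inj => //; lia.
  by move=> _ /mapP[x /g_bound xN ->]; rewrite mem_iota; lia.
rewrite size_map size_iota -(ler_nat R) => /le_trans; apply.
have NV : N%:R <= V + 1 by rewrite /N -natr1 lerD2r truncn_le.
by rewrite natrD; lra.
Qed.

Lemma finite_bounded_integers (i0 : 'I_d) (b : R) :
  finite_set [set x | x \in O /\ forall i, `|sigma i x| <= b].
Proof.
pose c := `|b| *+ 2 + 1.
apply: contrapT => /(@infinite_set_fset _ _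
  (Num.truncn (2 * (\prod_(i < d) c + 1))).+1)[B BO].
apply/negP; rewrite -ltnNge -(ltr_nat R).
apply: le_lt_trans (truncnS_gt _); apply: (size_box i0) => [i||x|x y i].
- by rewrite ltr_wpDl ?mulrn_wge0.
- exact: fset_uniq.
- by move=> /BO[].
move=> /BO[_ /(_ i) xb] /BO[_ /(_ i) yb]; apply: (le_trans (ler_normB _ _)).
by have := ler_norm b; rewrite /c; lra.
Qed.

Lemma finite_bounded_integer_mx (i0 : 'I_d) (b : R) :
  finite_set [set M : 'M[F]_2 | forall i j,
    M i j \in O /\ forall l, `|sigma l (M i j)| <= b].
Proof.
have Efin := finite_bounded_integers i0 b; set E := [set x | _] in Efin.
pose f (x : F * F * (F * F)) : 'M[F]_2 := \matrix_(i, j)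
  if i == 0 then (if j == 0 then x.1.1 else x.1.2)
  else (if j == 0 then x.2.1 else x.2.2).
apply: (@sub_finite_set _ _ (f @` ((E `*` E) `*` (E `*` E)))); last first.
  by apply: finite_image; do !apply: finite_setX.
move=> M ME; exists ((M 0 0, M 0 1), (M 1 0, M 1 1)); first by split; split; exact: ME.
by apply/matrixP => i j; rewrite !mxE; case/orP: (ord2 i) => /eqP->;
  case/orP: (ord2 j) => /eqP->.
Qed.

End DiscreteIntegers.

(** * Intersection numbers with a family of flats *)

Section DualCocycle.
Local Open Scope classical_set_scope.
Local Open Scope ring_scope.
Variables (R : realType) (F : fieldType) (d : nat) (K : numFieldType).
Variables (sigma : 'I_d -> {rmorphism F -> R}) (O : subringClosed F).

(** A point of the product of [d] upper half planes, see [sym_bounded]. *)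
Definition point := 'I_d -> 'M[R]_2.
Implicit Types (x : 'I_d.+1 -> point) (M g : 'M[F]_2).

Definition point_bounded C (p : point) := forall i, sym_bounded C (p i).

Definition point_act g (p : point) : point :=
  fun i => map_mx (sigma i) g *m p i *m (map_mx (sigma i) g)^T.

Definition sides M (i : 'I_d) (p : point) : K :=
  (side (map_mx (sigma i) M) (p i))%:R.

Definition flat_crossing M x : K := crossing (sides M) x.

(** The sum has finite support on bounded points when [A] is a family as below,
    see [intersection_finite]; otherwise it is 0 by convention. *)
Definition intersection (A : set 'M[F]_2) x : K :=
  \sum_(M \in A) flat_crossing M x.

Lemma flat_crossing_act g M x :
  flat_crossing M (point_act g \o x) = flat_crossing (g^T *m M *m g) x.
Proof.
have sidesE i p : sides M i (point_act g p) = sides (g^T *m M *m g) i p.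
  rewrite /sides /side /point_act !map_mxM map_trmx; congr (nat_of_bool (0 < _))%:R.
  by rewrite !mulmxA mxtrace_mulC !mulmxA.
by apply: eq_bigr => i _; rewrite /= !sidesE.
Qed.

Lemma intersection_act (A : set 'M[F]_2) g x :
  set_bij A A (fun M => g^T *m M *m g) ->
  intersection A (point_act g \o x) = intersection A x.
Proof.
move=> gA; rewrite /intersection (reindex_fsbig _ _ _ (fun M => flat_crossing M x) gA).
by apply: eq_fsbigr => M _; exact: flat_crossing_act.
Qed.

(** The integral matrices that stand for the translates of one flat: the ends of
    the flat are the zeros of [a] and [b], and [kappa], the determinant of the pair
    [a], [b], does not change under [SL_2]. *)
Definition rank_one_family (kappa : F) (A : set 'M[F]_2) : Prop :=
  forall M, A M -> [/\ forall i j, M i j \in O,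
    exists a b : 'rV[F]_2, M = b^T *m a & M 1 0 - M 0 1 = kappa].

Hypothesis norm_ge1 : norm_bounded_below sigma O.
Variables (i0 : 'I_d) (kappa : F) (A : set 'M[F]_2).
Hypothesis A_rank1 : rank_one_family kappa A.

(** If every factor of a crossing number is nonzero, the flat is crossed in every
    embedding. This bounds all conjugates of the entries of [M], and there are
    finitely many integers with bounded conjugates. *)
Lemma finite_crossing C : finite_set [set M | A M /\
  exists2 x, (forall k, point_bounded C (x k)) & flat_crossing M x != 0].
Proof.
apply: sub_finite_set (finite_bounded_integer_mx norm_ge1 i0
  (C ^+ 2 * \sum_i `|sigma i kappa|)).
move=> M [AM [x xC Mx]] i j; have [MO [a [b Mab]] Mk] := A_rank1 AM.
split=> // l; move: Mx; rewrite /flat_crossing /crossing (bigD1 l) //=.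
rewrite mulf_eq0 negb_or => /andP[Ml _].
set S := x (lift ord0 l) l; set S' := x (lift ord_max l) l.
have sideSS' : side (map_mx (sigma l) M) S != side (map_mx (sigma l) M) S'.
  by apply: contraNneq Ml => sSS'; rewrite subr_eq0 /sides sSS'.
have [SC S'C] : sym_bounded C S /\ sym_bounded C S' by split; apply: xC.
have MlE : map_mx (sigma l) M = (map_mx (sigma l) b)^T *m map_mx (sigma l) a.
  by rewrite Mab map_mxM map_trmx.
rewrite MlE in sideSS'; have := side_separation_bound SC S'C sideSS' i j.
rewrite -MlE !mxE -rmorphB Mk => bound.
have C_ge0 : 0 <= C by have [/(le_trans ler01)] := SC.
apply: (@le_trans _ _ (C ^+ 2 * `|sigma l kappa|)).
  rewrite -ler_sqr ?nnegrE ?mulr_ge0 //.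
  by rewrite exprMn !real_normK ?num_real // -exprM.
rewrite ler_wpM2l ?sqr_ge0 // (bigD1 l) //= lerDl.
by apply: sumr_ge0.
Qed.

Lemma intersection_finite C : exists r : seq 'M[F]_2,
  [/\ uniq r, forall M, M \in r -> A M &
   forall x, (forall k, point_bounded C (x k)) ->
     (forall M, A M -> M \notin r -> flat_crossing M x = 0) /\
     intersection A x = \sum_(M <- r) flat_crossing M x].
Proof.
have [r rE] := (finite_fsetP.1 (finite_crossing C)).
set E := [set M | _] in rE.
have rP M : M \in r <-> E M by rewrite rE.
exists r; split=> [|M|x xC]; first exact: fset_uniq.
  by move=> /rP[].
have r0 M : A M -> M \notin r -> flat_crossing M x = 0.
  move=> AM Mr; apply/eqP; apply: contraNT Mr => Mx.
  by apply/rP; split=> //; exists x.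
split=> //; apply: esym; rewrite fsbig_seq ?fset_uniq //.
apply: fsbig_widen => [M /rP[]//|M [AM Mr]] /=.
by apply: r0 => //; apply/negP.
Qed.

Lemma intersection_cocycle C (x : 'I_d.+2 -> point) :
  (forall k, point_bounded C (x k)) ->
  \sum_(k < d.+2) (-1) ^+ k * intersection A (x \o lift k) = 0.
Proof.
move=> xC; have [r [_ _ rE]] := intersection_finite C.
under eq_bigr => k _ do rewrite (rE _ (fun j => xC (lift k j))).2 mulr_sumr.
rewrite exchange_big big1 // => M _; exact: crossing_cocycle.
Qed.

End DualCocycle.

(** * Tori at a cusp *)

Section BoundedForms.
Variable R : realFieldType.

(** Adding a multiple of the square of a linear form is how points are raised
    towards a cusp; it commutes with the unipotents that fix the cusp. *)
Lemma sym_bounded_add_rank_one C (S : 'M[R]_2) (v : 'cV[R]_2) l : 0 <= l ->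
  sym_bounded C S -> exists C', sym_bounded C' (S + l *: (v *m v^T)).
Proof.
move=> l_ge0 [C1 S01 S00 S11 SP]; exists (C + l * (v 0 0 ^+ 2 + v 1 0 ^+ 2)).
have SE i j : (S + l *: (v *m v^T)) i j = S i j + l * (v i 0 * v j 0).
  by rewrite !mxE big_ord1 mxE.
have /= lv0 : 0 <= l * v 0 0 ^+ 2 by rewrite mulr_ge0 ?sqr_ge0.
have /= lv1 : 0 <= l * v 1 0 ^+ 2 by rewrite mulr_ge0 ?sqr_ge0.
split; rewrite ?SE; try by nra.
move=> x y.
have q_ge0 : 0 <= S 0 0 * x ^+ 2 + (S 0 1 * (x * y)) *+ 2 + S 1 1 * y ^+ 2.
  rewrite -(@pmulr_rge0 _ C) ?(lt_le_trans ltr01) //.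
  by apply: le_trans (SP x y); rewrite addr_ge0 ?sqr_ge0.
have lq_ge0 : 0 <= l * (v 0 0 * x + v 1 0 * y) ^+ 2 by rewrite mulr_ge0 ?sqr_ge0.
apply: le_trans (SP x y) _; apply: ler_pM => //; [lra|lra|].
by rewrite -subr_ge0 [X in 0 <= X](_ : _ = l * (v 0 0 * x + v 1 0 * y) ^+ 2) //; ring.
Qed.

Lemma uniform_sym_bounded (T : finType) (S : T -> 'M[R]_2) :
  (forall t, exists C, sym_bounded C (S t)) ->
  exists C, forall t, sym_bounded C (S t).
Proof.
move=> /choice[C SC]; exists (\sum_t C t) => t.
apply: sym_bounded_le (SC t); rewrite (bigD1 t) //= lerDl.
by apply: sumr_ge0 => s _; have [C1 _ _ _ _] := SC s; apply: le_trans C1.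
Qed.
End BoundedForms.

Lemma uniform_point_bounded (R : realType) d (T : finType) (P : T -> point R d) :
  (forall t, exists C, point_bounded C (P t)) ->
  exists C, forall t, point_bounded C (P t).
Proof.
move=> PC; have [[t i]|C H] := @uniform_sym_bounded R (T * 'I_d)%type (fun x => P x.1 x.2).
  by have [C H] := PC t; exists C; apply: H.
by exists C => t i; apply: (H (t, i)).
Qed.

Section Unipotent.
Variable F : comPzRingType.
Implicit Types c u w : F.

(** The vector whose line is the cusp [c]; [cusp_form c] vanishes on it. *)
Definition cusp_vec c : 'cV[F]_2 := \col_i (if i == 0 then c else 1).
Definition cusp_form c : 'rV[F]_2 := \row_i (if i == 0 then 1 else - c).
(** Translation by [u] at the cusp [c]. Writing it without a matrix that moves
    [c] to infinity keeps its entries integral when [c] and [u] are. *)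
Definition unip c u : 'M[F]_2 := 1%:M + u *: (cusp_vec c *m cusp_form c).

Lemma cusp_form_vec c : cusp_form c *m cusp_vec c = 0.
Proof. by apply/matrixP => i j; rewrite mulmx2 !mxE /= mulr1 mul1r subrr. Qed.

Lemma unip_vec c u : unip c u *m cusp_vec c = cusp_vec c.
Proof.
by rewrite mulmxDl mul1mx -scalemxAl -mulmxA cusp_form_vec mulmx0 scaler0 addr0.
Qed.

Lemma unipD c u w : unip c (u + w) = unip c u *m unip c w.
Proof.
rewrite {2}/unip mulmxDr mulmx1 -scalemxAr mulmxA unip_vec /unip.
by rewrite -addrA scalerDl.
Qed.

Lemma unip0 c : unip c 0 = 1%:M.
Proof. by rewrite /unip scale0r addr0. Qed.

Lemma unipE c u : [/\ unip c u 0 0 = 1 + u * c, unip c u 0 1 = - (u * c ^+ 2),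
  unip c u 1 0 = u & unip c u 1 1 = 1 - u * c].
Proof. by split; rewrite !mxE big_ord1 !mxE /=; ring. Qed.

Lemma det_unip c u : \det (unip c u) = 1.
Proof. by rewrite det_mx2; have [-> -> -> ->] := unipE c u; ring. Qed.

(** For [M = b^T *m a] this is the product of the values of [a] and [b] at
    [cusp_vec c]; it is 0 if and only if the flat of [M] ends at [c]. *)
Definition cusp_value c (M : 'M[F]_2) : F := \tr (M *m (cusp_vec c *m (cusp_vec c)^T)).

Lemma cusp_valueE c M :
  cusp_value c M = M 0 0 * c ^+ 2 + (M 0 1 + M 1 0) * c + M 1 1.
Proof.
by rewrite /cusp_value mxtrace2 !mulmx2 !mxE !big_ord1 !mxE /=; ring.
Qed.
End Unipotent.

Lemma map_unip (F R : comPzRingType) (f : {rmorphism F -> R}) c u :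
  map_mx f (unip c u) = unip (f c) (f u).
Proof.
apply/matrixP => i j; rewrite !mxE !big_ord1 !mxE !rmorphD rmorphM rmorph_nat /=.
by rewrite rmorphM !(fun_if f) rmorphN !rmorph1.
Qed.

Section CuspEvaluation.
Local Open Scope classical_set_scope.
Local Open Scope ring_scope.
Variables (R : realType) (F : fieldType) (d : nat) (K : numFieldType).
Variables (sigma : 'I_d -> {rmorphism F -> R}) (O : subringClosed F).
Hypothesis norm_ge1 : norm_bounded_below sigma O.
Variables (i0 : 'I_d) (kappa : F) (A : set 'M[F]_2).
Hypothesis A_rank1 : rank_one_family O kappa A.
Variables (c : F) (u : 'I_d -> F).
Hypothesis cO : c \in O.
Hypothesis A_unip : forall j, set_bij A A (fun M => (unip c (u j))^T *m M *m unip c (u j)).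

Definition cusp_point (l : R) (w : F) : point R d := fun i =>
  map_mx (sigma i) (unip c w) *m (map_mx (sigma i) (unip c w))^T +
  l *: (map_mx (sigma i) (cusp_vec c) *m (map_mx (sigma i) (cusp_vec c))^T).

(** The torus spanned by the [u j] at [c], raised by [l] towards the cusp. *)
Definition horoflag l (B : {set 'I_d}) := cusp_point l (\sum_(j in B) u j).

Lemma cusp_point_unip l w w' :
  cusp_point l (w + w') = point_act sigma (unip c w) (cusp_point l w').
Proof.
apply/funext => i; rewrite /point_act /cusp_point mulmxDr mulmxDl unipD !map_mxM.
rewrite trmx_mul !mulmxA; congr (_ + _); rewrite -scalemxAr -scalemxAl.
congr (_ *: _); rewrite !mulmxA -map_mxM unip_vec -mulmxA -trmx_mul -map_mxM.
by rewrite unip_vec.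
Qed.

Lemma cusp_point_bounded l w : 0 <= l -> exists C, point_bounded C (cusp_point l w).
Proof.
move=> l_ge0; apply: uniform_sym_bounded => i.
have [|C SC] := @sym_bounded_gram _ (map_mx (sigma i) (unip c w)).
  by rewrite det_map_mx det_unip rmorph1.
exact: sym_bounded_add_rank_one l_ge0 SC.
Qed.

Lemma horoflag_bounded l : 0 <= l ->
  exists C, forall B, point_bounded C (horoflag l B).
Proof. by move=> l_ge0; apply: uniform_point_bounded => B; apply: cusp_point_bounded. Qed.

(** Raising commutes with the unipotents at [c], so it can serve as the last step
    in [alt_sum_shift]. *)
Lemma alt_sum_raise l : 0 <= l ->
  alt_sum (intersection K sigma A) (horoflag l) =
  alt_sum (intersection K sigma A) (horoflag 0).
Proof.
move=> l_ge0.
(* The extra step [ord_max] raises the point; the others translate it. *)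
pose pt (B : {set 'I_d.+1}) := cusp_point (if ord_max \in B then l else 0)
  (\sum_(j | lift ord_max j \in B) u j).
have ptC (B : {set 'I_d.+1}) : exists C, point_bounded C (pt B).
  by apply: cusp_point_bounded; case: ifP.
have {ptC}[C ptC] := uniform_point_bounded ptC.
have ->: horoflag l = fun B : {set 'I_d} => pt (ord_max |: lift ord_max @: B).
  apply/funext => B; rewrite /pt !inE eqxx; congr (cusp_point _ _).
  apply: eq_bigl => j; rewrite !inE [_ == ord_max]eq_sym (negPf (neq_lift _ _)).
  by rewrite mem_imset //; exact: lift_inj.
have ->: horoflag 0 = fun B : {set 'I_d} => pt (lift ord_max @: B).
  apply/funext => B; rewrite /pt ifN; last first.
    by apply/imsetP => -[j _ /eqP]; apply/negP; exact: neq_lift.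
  congr (cusp_point _ _); apply: eq_bigl => j.
  by rewrite mem_imset //; exact: lift_inj.
apply: alt_sum_shift => [p|j B].
  by apply: (intersection_cocycle K norm_ge1 i0 A_rank1 (C := C)) => k; apply: ptC.
case: (unliftP ord_max j) => [m ->|->]; last by rewrite eqxx.
move=> _ mB; have -> : (fun k => pt (lift ord_max m |: B k)) =
    point_act sigma (unip c (u m)) \o (pt \o B).
  apply/funext => k; rewrite /pt /= -cusp_point_unip !inE (negPf (neq_lift _ _)) /=.
  congr (cusp_point _ _); rewrite (bigD1 m) ?inE ?eqxx //=; congr (_ + _).
  apply: eq_bigl => j'; rewrite !inE (inj_eq lift_inj).
  by case: eqP => [->|_] /=; rewrite ?andbF ?andbT ?(negPf (mB k)).
exact: intersection_act.
Qed.

Lemma cusp_value_integral M : A M -> cusp_value c M \in O.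
Proof.
by move=> AM; have [MO _ _] := A_rank1 AM; rewrite cusp_valueE !(rpredD, rpredM, rpredX).
Qed.

(** If a flat is crossed at height [l], then in every embedding the square of its
    value at the cusp is [O(1 / l)]. That value is an integer, so it is 0 for large
    [l]. *)
Lemma raised_crossing_eq0 : exists2 l, 0 <= l & forall M p,
  A M -> cusp_value c M != 0 -> flat_crossing K sigma M (flag_path (horoflag l) p) = 0.
Proof.
have [C H] := horoflag_bounded (lexx 0).
pose v i : 'cV[R]_2 := map_mx (sigma i) (cusp_vec c).
pose b i := sigma i kappa ^+ 2 * (C ^+ 2 + (C * (v i 0 0 ^+ 2 + v i 1 0 ^+ 2)) *+ 2).
have C_ge1 : 1 <= C by have [] := H finset.set0 i0.
have b_ge0 i : 0 <= b i.
  by rewrite mulr_ge0 ?sqr_ge0 // addr_ge0 ?sqr_ge0 // mulrn_wge0 // mulr_ge0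
     ?addr_ge0 ?sqr_ge0 // (le_trans ler01).
(* [l] exceeds every [b i], and [b i / l] bounds the square of the value at the
   cusp in the embedding [i]. *)
pose l := 1 + \sum_i b i.
have l_ge1 : 1 <= l by rewrite lerDl sumr_ge0.
exists l => [|M p AM q0]; first exact: le_trans l_ge1.
apply/eqP; apply: contraT; rewrite /flat_crossing /crossing.
move=> /prodf_neq0 cross; have := norm_ge1 (cusp_value_integral AM) q0.
apply: contraTT => _; rewrite -ltNge.
have qlt1 i : `|sigma i (cusp_value c M)| < 1.
  have := cross i isT; rewrite subr_eq0 /sides.
  set S := flag_path _ _ _ i; set S' := flag_path _ _ _ i => sSS'.
  have [MO [a' [b' Mab]] Mk] := A_rank1 AM.
  have MiE : map_mx (sigma i) M = (map_mx (sigma i) b')^T *m map_mx (sigma i) a'.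
    by rewrite Mab map_mxM map_trmx.
  have horoE B : horoflag l B i = horoflag 0 B i + l *: (v i *m (v i)^T).
    by rewrite /horoflag /cusp_point scale0r addr0.
  have sideSS' : side (map_mx (sigma i) M) S != side (map_mx (sigma i) M) S'.
    by apply: contraNneq sSS' => ->.
  rewrite /S /S' /flag_path !horoE MiE in sideSS'.
  have := side_separation_raised (H _ i) (H _ i) (le_trans ler01 l_ge1) sideSS'.
  rewrite -MiE {1}/v map_trmx -!map_mxM trace_map_mx -/(cusp_value c M).
  rewrite ![map_mx (sigma i) M _ _]mxE -rmorphB Mk => bound.
  rewrite -(@ltr_sqr _ `|_|) ?nnegrE ?normr_ge0 // expr1n real_normK ?num_real //.
  have bl : b i < l by rewrite /l (bigD1 i) //= addrA ltr_wpDr ?sumr_ge0 // ltrDr.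
  rewrite -(@ltr_pM2l _ (l ^+ 2)) ?exprn_gt0 ?(lt_le_trans ltr01) // -exprMn mulr1.
  apply: le_lt_trans bound _; apply: (@le_lt_trans _ _ (l * b i)); last first.
    by rewrite expr2 ltr_pM2l // (lt_le_trans ltr01).
  rewrite /b [X in _ <= X]mulrCA ler_wpM2l ?sqr_ge0 // [leRHS]mulrDr; apply: lerD.
    by rewrite ler_peMl ?sqr_ge0.
  by rewrite [leRHS]mulrnAr mulrA.
rewrite (bigD1 i0) //=; apply: le_lt_trans (qlt1 i0).
rewrite ler_piMr //; apply: numdomain.Num.Theory.prodr_ile1 => i _.
by rewrite normr_ge0 ltW.
Qed.

(** Only the flats that end at [c] meet the torus after raising it, and how they
    meet it does not depend on the height. *)
Lemma alt_sum_at_cusp :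
  alt_sum (intersection K sigma A) (horoflag 0) =
  alt_sum (intersection K sigma (A `&` [set M | cusp_value c M = 0])) (horoflag 0).
Proof.
have [l l_ge0 l0] := raised_crossing_eq0.
rewrite -(alt_sum_raise l_ge0).
apply: eq_bigr => p _; congr (_ * _).
transitivity (intersection K sigma (A `&` [set M | cusp_value c M = 0]) (flag_path (horoflag l) p)).
  apply/esym/fsbig_widen => [M []//|M [AM]] /=.
  by rewrite not_andP => -[//|/eqP]; exact: l0.
apply: eq_fsbigr => M /set_mem[AM /= q0].
have sidesE i B : sides K sigma M i (horoflag l B) = sides K sigma M i (horoflag 0 B).
  rewrite /sides /side /horoflag /cusp_point.
  have tr0 : \tr (map_mx (sigma i) M *m (map_mx (sigma i) (cusp_vec c) *m
      (map_mx (sigma i) (cusp_vec c))^T)) = 0.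
    by rewrite map_trmx -!map_mxM trace_map_mx [\tr _]q0 rmorph0.
  congr (nat_of_bool (0 < _))%:R; rewrite !mulmxDr !mxtraceD -!scalemxAr !mxtraceZ.
  by rewrite tr0 !mulr0.
by apply: eq_bigr => i _; rewrite /flag_path !sidesE.
Qed.

End CuspEvaluation.

(** * Counting crossings at the end of a flat *)

Section UnipotentTrace.
Variable F : comPzRingType.
Implicit Types (c w : F) (b : 'rV[F]_2).

Lemma rank_one_kappa c b (M := b^T *m cusp_form c) :
  M 1 0 - M 0 1 = b 0 1 + c * b 0 0.
Proof. by rewrite /M !mxE !big_ord1 !mxE /=; ring. Qed.

Lemma rank_one_trace c b : \tr (b^T *m cusp_form c) = b 0 0 - c * b 0 1.
Proof. by rewrite mxtrace2 !mxE !big_ord1 !mxE /=; ring. Qed.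

Lemma mxtrace_unip c w b (M := b^T *m cusp_form c) :
  \tr (M *m (unip c w *m (unip c w)^T)) =
  \tr M + (M 1 0 - M 0 1) * (1 + c ^+ 2) * w.
Proof.
rewrite rank_one_kappa rank_one_trace mxtrace2 !mulmx2.
have [u00 u01 u10 u11] := unipE c w.
rewrite ![_^T _ _]mxE u00 u01 u10 u11 /M !mxE !big_ord1 !mxE /=; ring.
Qed.
End UnipotentTrace.

Lemma ler1_dist_nat (R : numDomainType) (p q : nat) :
  p != q -> 1 <= `|p%:R - q%:R : R|.
Proof.
wlog pq : p q / (q < p)%N => [IH|_].
  by case: ltngtP => // pq _; [rewrite distrC|]; apply: IH; rewrite // neq_ltn pq ?orbT.
by rewrite -natrB ?(ltnW pq) // normr_nat ler1n subn_gt0.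
Qed.

(** Both [a] and [a'] are moved across 0 by adding the numbers from [z] to
    [z + w]. *)
Lemma threshold_close (R : realDomainType) (K : pzRingType) (a a' z w : R) :
  (0 < a + (z + w))%R%:R - (0 < a + z)%R%:R != 0 :> K ->
  (0 < a' + (z + w))%R%:R - (0 < a' + z)%R%:R != 0 :> K ->
  `|a - a'| <= `|w|.
Proof.
have sep (t : R) : (0 < t + (z + w))%R%:R - (0 < t + z)%R%:R != 0 :> K ->
    (0 < t + (z + w)) != (0 < t + z).
  by apply: contraNneq => ->; rewrite subrr.
move=> /sep + /sep; rewrite ler_norml.
have [h1|h1] := ltP 0 (a + (z + w)); have [h2|h2] := ltP 0 (a + z) => // _;
have [h3|h3] := ltP 0 (a' + (z + w)); have [h4|h4] := ltP 0 (a' + z) => // _;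
case: (ger0P w) => hw; apply/andP; split; lra.
Qed.

Section Count.
Local Open Scope classical_set_scope.
Local Open Scope ring_scope.
Variables (R : realType) (F : fieldType) (d : nat) (K : numFieldType).
Variables (sigma : 'I_d -> {rmorphism F -> R}) (O : subringClosed F).
Hypothesis norm_ge1 : norm_bounded_below sigma O.
Variables (i0 : 'I_d) (kappa : F) (A : set 'M[F]_2) (c : F).
Hypothesis A_rank1 : rank_one_family O kappa A.
Hypothesis A_cusp : forall M, A M -> exists b : 'rV[F]_2, M = b^T *m cusp_form c.
Hypothesis kappa0 : kappa != 0.

Let kappa' := kappa * (1 + c ^+ 2).

Lemma kappa'0 : kappa' != 0.
Proof.
rewrite mulf_neq0 // -(fmorph_eq0 (sigma i0)) rmorphD rmorph1 rmorphXn.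
by rewrite gt_eqF // ltr_wpDr ?sqr_ge0.
Qed.

(** A flat with one end at [c] is given by its other end, and the trace is an
    affine coordinate for that end. *)
Lemma mxtrace_inj M M' : A M -> A M' -> \tr M = \tr M' -> M = M'.
Proof.
move=> AM AM'; have [b Mb] := A_cusp AM; have [b' Mb'] := A_cusp AM'.
have [_ _] := A_rank1 AM'; have [_ _] := A_rank1 AM.
rewrite {}Mb {}Mb' !rank_one_kappa !rank_one_trace => <- kE tE.
have c0 : 1 + c ^+ 2 != 0 by have := kappa'0; rewrite mulf_eq0 negb_or => /andP[].
have b0E : b 0 0 = b' 0 0.
  apply/eqP; rewrite -subr_eq0 -(mulIr_eq0 _ (mulIf c0)); apply/eqP.
  have -> : (b 0 0 - b' 0 0) * (1 + c ^+ 2) = (b 0 0 - c * b 0 1 - (b' 0 0 - c * b' 0 1)) +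
    c * (b 0 1 + c * b 0 0 - (b' 0 1 + c * b' 0 0)) by ring.
  by rewrite tE kE !subrr mulr0 addr0.
congr (_^T *m _); apply/rowP => i; case/orP: (ord2 i) => /eqP-> //.
by move: kE; rewrite b0E => /addIr.
Qed.

(** Seen from [c], a flat ending there is a vertical geodesic in every factor, and
    a point is on one or the other side according to its horizontal coordinate. *)
Lemma side_unip M w i : A M ->
  side (map_mx (sigma i) M) (cusp_point sigma c 0 w i) =
  (0 < sigma i (\tr M) + sigma i kappa' * sigma i w).
Proof.
move=> AM; have [b Mb] := A_cusp AM; have [_ _ kE] := A_rank1 AM.
rewrite /kappa' -kE /side /cusp_point scale0r addr0 map_trmx -!map_mxM trace_map_mx.
by rewrite {1}Mb mxtrace_unip -Mb rmorphD !rmorphM.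
Qed.

Lemma sum_prefix_set (u : 'I_d -> F) (p : 'S_d) (i : 'I_d) :
  \sum_(j in prefix_set p i.+1) u j = \sum_(j in prefix_set p i) u j + u (p i).
Proof.
rewrite (bigD1 (p i)) ?mem_prefix_set ?permK //= addrC; congr (_ + _).
apply: eq_bigl => j; rewrite !mem_prefix_set -(inj_eq (@perm_inj _ p^-1%g)) permK.
by rewrite -val_eqE ltnS andbC -ltn_neqAle.
Qed.

Section Path.
Variables (u : 'I_d -> F) (p : 'S_d).
Let x (i : 'I_d) := sigma i (\sum_(j in prefix_set p i) u j).
Let cross M := flat_crossing K sigma M (flag_path (horoflag sigma c u 0) p).

Lemma flag_crossing M : A M -> cross M = \prod_(i < d)
  ((0 < sigma i (\tr M) + sigma i kappa' * (x i + sigma i (u (p i))))%R%:R -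
   (0 < sigma i (\tr M) + sigma i kappa' * x i)%R%:R).
Proof.
move=> AM; apply: eq_bigr => i _; rewrite /sides !side_unip //.
rewrite -rmorphD -sum_prefix_set; congr ((0 < _ + _ * sigma _ (\sum_(j in prefix_set p _) _))%R%:R - _).
by have -> : lift ord_max i = i :> nat by exact: lift_max.
Qed.

Lemma flag_crossing_norm M : A M -> `|cross M| = (cross M != 0)%:R.
Proof.
move=> AM; rewrite flag_crossing //; case: eqVneq => [->|]; first by rewrite normr0.
move=> /prodf_neq0 nz; rewrite normr_prod big1 // => i _; have := nz i isT.
by do 2![case: (0 < _)%R]; rewrite ?subrr ?eqxx ?subr0 ?sub0r ?normrN ?normr1.
Qed.

(** The flats crossed by one flag of the torus have their traces in a box with
    sides the steps of the flag. *)
Lemma count_flag_crossing_le (r : seq 'M[F]_2) (b : 'I_d -> R) :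
  uniq r -> (forall M, M \in r -> A M) -> (forall i, 0 < b i) ->
  (forall i, `|sigma i kappa' * sigma i (u (p i))| <= b i) ->
  (count (fun M => cross M != 0) r)%:R <= 2 * (\prod_(i < d) b i + 1).
Proof.
move=> r_uniq rA b_gt0 ub.
pose s := [seq \tr M | M <- r & cross M != 0].
have sP t : t \in s -> exists2 M, A M & t = \tr M /\ cross M != 0.
  case/mapP => M; rewrite mem_filter => /andP[MX /rA AM] ->.
  by exists M.
have -> : count (fun M => cross M != 0) r = size s by rewrite size_map size_filter.
apply: (size_box norm_ge1 i0) => // [|t /sP[M AM [-> _]]|t t' i].
- rewrite map_inj_in_uniq ?filter_uniq // => M M'.
  by rewrite !mem_filter => /andP[_ /rA AM] /andP[_ /rA AM'] /mxtrace_inj ->.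
- by have [MO _ _] := A_rank1 AM; rewrite mxtrace2 rpredD.
move=> /sP[M AM [-> Mx]] /sP[M' AM' [-> M'x]]; apply: le_trans (ub i).
move: Mx M'x; rewrite !flag_crossing // => /prodf_neq0/(_ i isT) + /prodf_neq0/(_ i isT).
rewrite mulrDr; apply: threshold_close.
Qed.
End Path.

Definition horo_cross u p M : K :=
  flat_crossing K sigma M (flag_path (horoflag sigma c u 0) p).

Section MainTerm.
Variables (L : set F) (rho : R) (M0 : 'M[F]_2).
Hypothesis A_L : forall l M, L l -> A M -> A ((unip c l)^T *m M *m unip c l).
Hypothesis rho_ge1 : 1 <= rho.
Hypothesis L_cobounded : forall y : 'I_d -> R,
  exists2 l, L l & forall i, `|sigma i l - y i| <= rho.
Hypothesis AM0 : A M0.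
Variables (n : nat) (u : 'I_d -> F).
Hypothesis n_ge2 : (2 <= n)%N.
Hypothesis u_diag : forall i j,
  `|sigma i (u j) - (4 * rho * n%:R) *+ (i == j)| <= rho.

Let u_diag_gt i : 4 * rho * n%:R - rho <= sigma i (u i).
Proof. by have := u_diag i i; rewrite eqxx mulr1n ler_norml => /andP[]; lra. Qed.

Let rho_n : rho * 2 <= rho * n%:R.
Proof. by rewrite ler_wpM2l ?(le_trans ler01) // (ler_nat R 2). Qed.

(** On the flag of the identity every step is positive in its own coordinate, so
    all crossings of a factor have the sign of [kappa'] there. *)
Lemma horo_cross_sign M : A M -> horo_cross u 1 M =
  (\prod_(i < d) (-1) ^+ (sigma i kappa' < 0)%R) * (horo_cross u 1 M != 0)%:R.
Proof.
move=> AM; rewrite /horo_cross flag_crossing //.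
case: eqVneq => [->|]; first by rewrite mulr0.
rewrite mulr1 => /prodf_neq0 nz; apply: eq_bigr => i _; have := nz i isT; rewrite perm1.
have ui : 0 < sigma i (u i).
  have := u_diag_gt i; have := rho_n; move: rho_ge1; nra.
have k0 : sigma i kappa' != 0 by rewrite fmorph_eq0 kappa'0.
rewrite mulrDr; move: (sigma i kappa' * sigma i (\sum_(j in _) _)) => z.
move: (sigma i (\tr M)) => a; case: (ltP (sigma i kappa') 0) => kp.
  have : sigma i kappa' * sigma i (u i) < 0 by rewrite nmulr_rlt0 // ui.
  move: (_ * _) => w w0.
  case: (ltP 0 (a + (z + w))) => h1; case: (ltP 0 (a + z)) => h2;
    rewrite ?subrr ?eqxx // ?mulr0n ?mulr1n ?sub0r ?expr1 //; exfalso; lra.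
have : 0 < sigma i kappa' * sigma i (u i).
  by rewrite mulr_gt0 // lt_def k0.
move: (_ * _) => w w0.
by case: (ltP 0 (a + (z + w))) => h1; case: (ltP 0 (a + z)) => h2;
  rewrite ?subrr ?eqxx // ?mulr0n ?mulr1n ?subr0 ?expr0 //; exfalso; lra.
Qed.

(** The long box of the identity contains [n ^ d] points of [L] that are close to
    the points of a grid of mesh [3 * rho]; they move [M0] to distinct flats that
    are crossed. *)
Lemma count_main_ge (r : seq 'M[F]_2) :
  (forall M, A M -> M \notin r -> horo_cross u 1 M = 0) ->
  (n ^ d <= count (fun M => horo_cross u 1 M != 0%R) r)%N.
Proof.
move=> r_full.
pose x i := sigma i (\sum_(j in prefix_set (1 : 'S_d) i) u j).
(* The offset [2 * rho] keeps the approximating points inside the box. *)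
pose y (m : {ffun 'I_d -> 'I_n}) i := - (sigma i (\tr M0) / sigma i kappa') -
  (x i + sigma i (u i)) + 2 * rho + 3 * rho * (m i)%:R.
have /choice[l lP] : forall m : {ffun 'I_d -> 'I_n}, exists l,
    L l /\ forall i, `|sigma i l - y m i| <= rho.
  by move=> m; have [l Ll lE] := L_cobounded (y m); exists l.
pose N m := (unip c (l m))^T *m M0 *m unip c (l m).
have AN m : A (N m) by apply: A_L AM0; have [] := lP m.
have trN m : \tr (N m) = \tr M0 + kappa' * l m.
  rewrite /N -mulmxA mxtrace_mulC -mulmxA.
  have [b Mb] := A_cusp AM0; have [_ _ kE] := A_rank1 AM0.
  by rewrite /kappa' -kE {1}Mb mxtrace_unip -Mb.
have Nx m : horo_cross u 1 (N m) != 0.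
  rewrite /horo_cross flag_crossing //; apply/prodf_neq0 => i _.
  rewrite perm1 trN rmorphD rmorphM -/(x i).
  have [_ /(_ i)] := lP m; rewrite /y.
  have k0 : sigma i kappa' != 0 by rewrite fmorph_eq0 kappa'0.
  have mn : (m i)%:R + 1 <= n%:R :> R by rewrite natr1 ler_nat.
  have m0 : 0 <= (m i)%:R :> R by [].
  have := u_diag_gt i; move: rho_ge1 rho_n.
  have -> : sigma i (\tr M0) = sigma i kappa' * (sigma i (\tr M0) / sigma i kappa').
    by rewrite mulrCA mulfV ?mulr1.
  have -> : sigma i kappa' * (sigma i (\tr M0) / sigma i kappa') / sigma i kappa' =
    sigma i (\tr M0) / sigma i kappa' by rewrite mulrAC mulfV ?mul1r.
  rewrite -!mulrDr; move: (_ / _) => t; rewrite ler_norml.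
  move: (sigma i (l m)) (x i) (sigma i (u i)) ((m i)%:R) (n%:R) mn m0 => lm xi ui mi nn.
  move=> mn m0 r1 rn hu /andP[hl1 hl2].
  have mr : rho * mi + rho <= rho * nn by nra.
  have lo : 0 < t + lm + (xi + ui) by nra.
  have hi : t + lm + xi < 0 by nra.
  case: (ltP (sigma i kappa') 0) => kp.
    by rewrite nmulr_rgt0 // nmulr_rgt0 // hi ltNge (ltW lo) /= sub0r oppr_eq0 oner_eq0.
  have {}kp : 0 < sigma i kappa' by rewrite lt_def k0.
  by rewrite pmulr_rgt0 // pmulr_rgt0 // lo ltNge (ltW hi) /= subr0 oner_eq0.
have N_inj : injective N.
  move=> m m' /(congr1 (@mxtrace F 2)); rewrite !trN => /addrI/(mulfI kappa'0) lE.
  apply/ffunP => i; apply/val_inj/eqP; rewrite -(eqr_nat R) -subr_eq0.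
  have [_ /(_ i) h] := lP m; have [_ /(_ i) h'] := lP m'.
  apply/negPn/negP => neq; have : 1 <= `|(m i)%:R - (m' i)%:R : R|.
    by apply: ler1_dist_nat; rewrite subr_eq0 eqr_nat in neq.
  apply/negP; rewrite -ltNge; move: h h'; rewrite lE /y.
  rewrite !ler_norml => /andP[h1 h2] /andP[h3 h4]; rewrite ltr_norml.
  have := rho_ge1; move: ((m i)%:R) ((m' i)%:R) h1 h2 h3 h4 => p q h1 h2 h3 h4 r1.
  have pq1 : rho * (p - q) * 3 <= rho * 2 by lra.
  have pq2 : - (rho * 2) <= rho * (p - q) * 3 by lra.
  by apply/andP; split; nra.
rewrite -[(n ^ d)%N](_ : #|{ffun 'I_d -> 'I_n}| = _); last by rewrite card_ffun !card_ord.
rewrite cardE -(size_map N) -size_filter; apply: uniq_leq_size.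
  by rewrite map_inj_uniq ?enum_uniq.
move=> _ /mapP[m _ ->]; rewrite mem_filter Nx /=.
by apply: contraNT (Nx m) => /(r_full _ (AN m))/eqP.
Qed.

End MainTerm.

Section Nonvanishing.
Variables (L : set F) (rho : R) (M0 : 'M[F]_2).
Hypothesis A_L : forall l M, L l -> A M -> A ((unip c l)^T *m M *m unip c l).
Hypothesis rho_ge1 : 1 <= rho.
Hypothesis L_cobounded : forall y : 'I_d -> R,
  exists2 l, L l & forall i, `|sigma i l - y i| <= rho.
Hypothesis AM0 : A M0.

(** For some [i1], the step [u (p i1)] is short in the coordinate [i1], so that the
    box of [p] has one side of bounded length. *)
Lemma off_diagonal_bound (n : nat) (u : 'I_d -> F) (p : 'S_d) (r : seq 'M[F]_2) :
  (2 <= n)%N ->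
  (forall i j, `|sigma i (u j) - (4 * rho * n%:R) *+ (i == j)| <= rho) ->
  uniq r -> (forall M, M \in r -> A M) -> p != 1%g ->
  (count (fun M => horo_cross u p M != 0) r)%:R <=
  2 * (\prod_i `|sigma i kappa'| * (5 * rho) ^+ d + 1) * n%:R ^+ d.-1.
Proof.
move=> n_ge2 u_diag r_uniq rA p1.
have rho_gt0 : 0 < rho by exact: lt_le_trans rho_ge1.
have n_ge1 : 1 <= n%:R :> R by rewrite ler1n ltnW.
have [i1 pi1] : exists i, p i != i.
  apply/existsP; apply: contraNT p1; rewrite negb_exists => /forallP pE.
  by apply/eqP/permP => i; rewrite perm1; apply/eqP; rewrite -[_ == _]negbK pE.
pose b i := if p i == i then 5 * rho * n%:R else rho.
have b_gt0 i : 0 < b i by rewrite /b; case: ifP => _ //; rewrite !mulr_gt0 // ltr0n ltnW.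
have nb i : `|sigma i kappa'| > 0 by rewrite normr_gt0 fmorph_eq0 kappa'0.
have := @count_flag_crossing_le u p r (fun i => `|sigma i kappa'| * b i) r_uniq rA.
move=> /(_ (fun i => mulr_gt0 (nb i) (b_gt0 i))) H.
apply: le_trans (H _) _ => [i|].
  rewrite normrM ler_wpM2l // /b; have := u_diag i (p i); rewrite [i == _]eq_sym.
  case: eqP => _ h; rewrite ?mulr1n ?mulr0n ?subr0 // in h *.
  move: h; rewrite !ler_norml => /andP[]; move: (sigma _ _) => s; nra.
rewrite -mulrA ler_wpM2l // mulrDl mul1r; apply: lerD; last first.
  by apply: exprn_ege1.
rewrite big_split /= -mulrA ler_wpM2l ?prodr_ge0 //.
have [d' dE] : exists d', d = d'.+1 by exists d.-1; rewrite prednK // (leq_ltn_trans _ (ltn_ord i1)).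
rewrite (bigD1 i1) //= {1}/b (negPf pi1).
apply: (@le_trans _ _ (5 * rho * (5 * rho * n%:R) ^+ d.-1)); last first.
  by rewrite dE exprMn exprS mulrA.
apply: ler_pM; [exact: ltW | by apply: prodr_ge0 => i _; exact: ltW | lra |].
rewrite -[d.-1](_ : #|predC1 i1| = _); last first.
  by rewrite cardC1 card_ord.
rewrite -prodr_const; apply: ler_prod => i _; rewrite ltW //= /b; case: ifP => _ //.
by nra.
Qed.

(** If the value were 0, the count for the identity would be at most the sum of
    the others, but it grows faster with [n]. *)
Theorem horo_alt_sum_neq0 : exists2 u : 'I_d -> F, forall j, L (u j) &
  alt_sum (intersection K sigma A) (horoflag sigma c u 0) != 0.
Proof.
pose D := \prod_i `|sigma i kappa'|.
pose E := #|{perm 'I_d}|%:R * (2 * (D * (5 * rho) ^+ d + 1)).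
(* [E * n ^ d.-1] bounds the sum of the counts of the other permutations. *)
pose n := maxn 2 (Num.truncn E).+1.
have n_ge2 : (2 <= n)%N by exact: leq_maxl.
have En : E < n%:R by apply: lt_le_trans (truncnS_gt _) _; rewrite ler_nat leq_maxr.
have /choice[u uP] : forall j : 'I_d, exists l, L l /\
    forall i, `|sigma i l - (4 * rho * n%:R) *+ (i == j)| <= rho.
  by move=> j; have [l] := L_cobounded (fun i => (4 * rho * n%:R) *+ (i == j)); exists l.
exists u => [j|]; first by have [] := uP j.
have u_diag i j : `|sigma i (u j) - (4 * rho * n%:R) *+ (i == j)| <= rho.
  by have [_] := uP j.
have [C H] := horoflag_bounded sigma c u (lexx 0).
have [r [r_uniq rA rE]] := intersection_finite K norm_ge1 i0 A_rank1 C.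
have {}rE p := rE (flag_path (horoflag sigma c u 0) p) (fun k => H _).
pose cnt p := count (fun M => horo_cross u p M != 0) r.
have sum_norm p : `|\sum_(M <- r) horo_cross u p M| <= (cnt p)%:R.
  apply: le_trans (ler_norm_sum _ _ _) _; rewrite /cnt -sum1_count natr_sum [leRHS]big_mkcond.
  rewrite big_seq [leRHS]big_seq; apply: ler_sum => M /rA AM.
  by rewrite /horo_cross flag_crossing_norm //; case: ifP.
have sum1_norm : `|\sum_(M <- r) horo_cross u 1 M| = (cnt 1%g)%:R.
  rewrite big_seq (eq_bigr (fun M => _ * _) (fun M Mr => horo_cross_sign rho_ge1 n_ge2 u_diag (rA M Mr))).
  rewrite -mulr_sumr -big_seq normrM normr_prod big1 ?mul1r; last first.
    by move=> i _; rewrite normrX normrN1 expr1n.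
  rewrite /cnt -sum1_count natr_sum [in RHS]big_mkcond ger0_norm ?sumr_ge0 //.
  by apply: eq_bigr => M _; case: ifP.
apply/eqP; rewrite /alt_sum (eq_bigr (fun p : 'S_d => (-1) ^+ p *
    \sum_(M <- r) horo_cross u p M)) => [|p _]; last by rewrite (rE p).2.
rewrite (bigD1 1%g) //= odd_perm1 mul1r => /eqP; rewrite addr_eq0 => /eqP sumE.
have : (cnt 1%g <= \sum_(p : 'S_d | p != 1%g) cnt p)%N.
  rewrite -(ler_nat K) -sum1_norm sumE normrN natr_sum.
  apply: le_trans (ler_norm_sum _ _ _) (ler_sum _ _) => p _.
  by rewrite normrM normrX normrN1 expr1n mul1r.
apply/negP; rewrite -ltnNge; apply: leq_trans (count_main_ge A_L rho_ge1 L_cobounded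
  AM0 n_ge2 u_diag (rE 1%g).1).
rewrite -(ltr_nat R) natr_sum natrX.
apply: (@le_lt_trans _ _ (E * n%:R ^+ d.-1)).
  have D_ge0 : 0 <= 2 * (D * (5 * rho) ^+ d + 1) * n%:R ^+ d.-1.
    rewrite !mulr_ge0 ?exprn_ge0 // addr_ge0 // mulr_ge0 ?prodr_ge0 // exprn_ge0 //.
    by rewrite mulr_ge0 // (le_trans ler01).
  rewrite /E -mulrA mulr_natl -sumr_const big_mkcond; apply: ler_sum => p _.
  by case: ifP => // p1; apply: off_diagonal_bound.
have [d' dE] : exists d', d = d'.+1 by exists d.-1; rewrite prednK // (leq_ltn_trans _ (ltn_ord i0)).
by rewrite dE exprS ltr_pM2r // exprn_gt0 // ltr0n (leq_trans _ n_ge2).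
Qed.
End Nonvanishing.
End Count.

(** * Subgroups of finite index *)

Section FiniteIndex.
Local Open Scope classical_set_scope.
Variable G : groupType.
Implicit Types (H K L : {pred G}).

Definition left_coset H (k : G) : set G := [set (k * h)%g | h in [set` H]].

Lemma eq_finite_index H H' K : H =i H' -> finite_index H K -> finite_index H' K.
Proof.
move=> HH' [HK finH]; split=> [x|]; first by rewrite -HH'; apply: HK.
suff <- : [set` H] = [set` H'] by [].
by apply/seteqP; split=> x /=; rewrite HH'.
Qed.

(** Cosets of [H] in [L] are translates, by representatives of the cosets of [K]
    in [L], of cosets of [H] in [K]. *)
Lemma finite_index_trans H K L : (1%g : G) \in K ->
  finite_index H K -> finite_index K L -> finite_index H L.
Proof.
move=> K1 [HK finH] [KL finK]; split=> [x /HK/KL//|].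
have /choice[r rP] : forall C, exists k, (left_coset K @` [set` L]) C ->
    k \in L /\ left_coset K k = C.
  move=> C; have [[k Lk <-]|nC] := pselect ((left_coset K @` [set` L]) C).
    by exists k.
  by exists 1%g.
pose f (p : set G * set G) : set G := [set (r p.1 * x)%g | x in p.2].
apply: sub_finite_set (finite_image f (finite_setX finK finH)).
move=> _ [k Lk <-] /=; pose C := left_coset K k.
have CP : (left_coset K @` [set` L]) C by exists k.
have [Lr rC] := rP C CP.
have : C k by exists 1%g => //; rewrite mulg1.
rewrite -rC => -[h Kh hk]; exists (C, left_coset H h).
  by split=> //; exists h.
rewrite /f /=; apply/seteqP; split=> [_ [_ [y Hy <-] <-]|_ [y Hy <-]].
  by exists y => //; rewrite -hk mulgA.
by exists (h * y)%g; [exists y|rewrite mulgA hk].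
Qed.

Lemma finite_index_map (T : Type) (f : G -> T) H K :
  {subset H <= K} -> finite_set (f @` [set` K]) ->
  (forall k k', k \in K -> k' \in K -> f k = f k' -> left_coset H k = left_coset H k') ->
  finite_index H K.
Proof.
move=> HK finf fH; split=> //.
have [r rP] : exists r : T -> set G, forall k, k \in K -> r (f k) = left_coset H k.
  have /choice[r rP] : forall t, exists C, forall k, k \in K -> f k = t -> left_coset H k = C.
    move=> t; have [[k Kk <-]|nt] := pselect ((f @` [set` K]) t).
      by exists (left_coset H k) => k' Kk'; apply: fH.
    by exists set0 => k Kk fk; case: nt; exists k.
  by exists r => k Kk; apply/esym/rP.
apply: sub_finite_set (finite_image r finf) => _ [k Kk <-].
by exists (f k); [exists k|exact: rP].
Qed.

(** The exponent is a factorial, so that one exponent serves all [k]: two of the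
    first powers of [k] are in the same coset, and the difference of their
    exponents divides the factorial. *)
Lemma finite_index_exponent (H : groupClosed G) (K : {pred G}) :
  (forall x n, x \in K -> (x ^+ n)%g \in K) -> finite_index H K ->
  exists2 N, (0 < N)%N & forall k, k \in K -> (k ^+ N)%g \in H.
Proof.
move=> KX [_ /finite_seqP[s sE]]; exists (size s)`!; first exact: fact_gt0.
move=> k Kk; pose phi i := left_coset H (k ^+ i)%g.
have phi_s i : phi i \in s.
  have : ([set left_coset H k | k in [set` K]] : set (set G)) (phi i).
    by exists (k ^+ i)%g => //=; apply: KX.
  by rewrite [X in X _]sE.
have : ~~ uniq [seq phi i | i <- iota 0 (size s).+1].
  apply/negP => s_uniq; suff: ((size s).+1 <= size s)%N by rewrite ltnn.
  rewrite -[(size s).+1](size_iota 0) -(size_map phi); apply: uniq_leq_size s_uniq _.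
  by move=> _ /mapP[i _ ->].
move=> /(uniqPn (phi 0))[i [j [ij]]]; rewrite size_map size_iota => js.
rewrite !(nth_map 0) ?size_iota ?(ltn_trans ij) // !nth_iota ?(ltn_trans ij) // !add0n => ijE.
have : phi j (k ^+ j)%g by exists 1%g; rewrite ?mulg1 //=; apply: gpred1.
rewrite -ijE => -[h /= Hh hE].
have kH : (k ^+ (j - i))%g \in H.
  suff <- : h = (k ^+ (j - i))%g by [].
  by apply: (mulgI (k ^+ i)%g); rewrite hE -expgD subnKC // ltnW.
have /dvdnP[q ->] : (j - i %| (size s)`!)%N.
  by rewrite dvdn_fact // subn_gt0 ij (leq_trans (leq_subr _ _)).
by rewrite mulnC expgM; apply: gpredXn.
Qed.
End FiniteIndex.

(** * Congruence subgroups and orbits of flats *)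

Section SL2.
Variable F : fieldType.
Implicit Types (A B : SL 2 F) (c u : F).

(** The adjugate, entry by entry: it shows that inverses stay integral. *)
Lemma SL2_invE A : [/\ (A^-1)%g 0 0 = A 1 1, (A^-1)%g 0 1 = - A 0 1,
  (A^-1)%g 1 0 = - A 1 0 & (A^-1)%g 1 1 = A 0 0].
Proof.
pose B : 'M[F]_2 := \matrix_(i, j) if i == 0 then (if j == 0 then A 1 1 else - A 0 1)
  else (if j == 0 then - A 1 0 else A 0 0).
have BA : B *m A = 1%:M.
  have := SL_det A; rewrite det_mx2 => detA.
  apply/matrixP => i j; rewrite mulmx2 !mxE.
  by case/orP: (ord2 i) => /eqP ->; case/orP: (ord2 j) => /eqP -> /=;
    rewrite ?mulr1n ?mulr0n -?detA; ring.
have AAV : A *m SL_mx (A^-1)%g = 1%:M by exact: (congr1 val (mulgV A)).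
have AV : SL_mx (A^-1)%g = B.
  by rewrite -[LHS]mul1mx -BA -mulmxA AAV mulmx1.
by split; rewrite AV !mxE.
Qed.

Definition SL_unip_subproof c u : \det (unip c u) == 1.
Proof. by rewrite det_unip. Qed.
Definition SL_unip c u : SL 2 F := MkSL (SL_unip_subproof c u).

Lemma SL_unipD c u w : SL_unip c (u + w) = (SL_unip c u * SL_unip c w)%g.
Proof. by apply: val_inj; rewrite /= unipD. Qed.

Lemma SL_unip0 c : SL_unip c 0 = 1%g.
Proof. by apply: val_inj; rewrite /= unip0. Qed.

Lemma SL_unipX c u n : SL_unip c (u *+ n) = (SL_unip c u ^+ n)%g.
Proof.
by elim: n => [|n IH]; rewrite ?SL_unip0 // mulrS SL_unipD IH expgS.
Qed.

Section Congruence.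
Variables (O : subringClosed F) (n : nat).

Definition congruent_to_one : {pred SL 2 F} := fun A =>
  `[< forall i j, exists2 b, b \in O & A i j = (i == j)%:R + n%:R * b >].

Lemma congruent_to_oneP A : reflect
  (forall i j, exists2 b, b \in O & A i j = (i == j)%:R + n%:R * b)
  (A \in congruent_to_one).
Proof. exact: asboolP. Qed.

Lemma congruent_to_one_integral A : A \in congruent_to_one -> forall i j, A i j \in O.
Proof.
move=> /congruent_to_oneP AO i j; have [b bO ->] := AO i j.
by rewrite rpredD ?rpredM ?rpred_nat.
Qed.

Lemma congruent_to_one1 : 1%g \in congruent_to_one.
Proof.
by apply/congruent_to_oneP => i j; exists 0; rewrite ?rpred0 // mulr0 addr0 mxE.
Qed.

Lemma congruent_to_oneM A B : A \in congruent_to_one -> B \in congruent_to_one ->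
  (A * B)%g \in congruent_to_one.
Proof.
move=> AO BO; have Aint := congruent_to_one_integral AO.
move: AO BO => /congruent_to_oneP AO /congruent_to_oneP BO.
apply/congruent_to_oneP => i j; have [a aO aE] := AO i j.
have [b0 b0O b0E] := BO 0 j; have [b1 b1O b1E] := BO 1 j.
exists (a + (A i 0 * b0 + A i 1 * b1)); first by rewrite !(rpredD, rpredM).
rewrite mulmx2 b0E b1E [n%:R * (a + _)]mulrDr [RHS]addrA -aE.
by case/orP: (ord2 j) => /eqP -> /=; ring.
Qed.

Lemma congruent_to_oneV A : A \in congruent_to_one -> (A^-1)%g \in congruent_to_one.
Proof.
move=> /congruent_to_oneP AO; apply/congruent_to_oneP => i j.
have [V00 V01 V10 V11] := SL2_invE A.
case/orP: (ord2 i) => /eqP ->; case/orP: (ord2 j) => /eqP -> /=.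
- by rewrite V00; exact: AO.
- by rewrite V01; have [b bO ->] := AO 0 1; exists (- b); rewrite ?rpredN //=; ring.
- by rewrite V10; have [b bO ->] := AO 1 0; exists (- b); rewrite ?rpredN //=; ring.
by rewrite V11; exact: AO.
Qed.

Variable Gamma : groupClosed (SL 2 F).

(** The entries of its elements are integral, even if those of [Gamma] are not. *)
Definition congruence_part : {pred SL 2 F} := [predI Gamma & congruent_to_one].

Lemma congruence_partP A :
  reflect (A \in Gamma /\ A \in congruent_to_one) (A \in congruence_part).
Proof. exact: andP. Qed.

Lemma congruence_part1 : 1%g \in congruence_part.
Proof. by apply/congruence_partP; rewrite gpred1 congruent_to_one1. Qed.

Lemma congruence_partM : mulg_closed congruence_part.
Proof.
move=> A B /congruence_partP[AG Ac] /congruence_partP[BG Bc].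
by apply/congruence_partP; rewrite gpredM // congruent_to_oneM.
Qed.

Lemma congruence_partV : invg_closed congruence_part.
Proof.
move=> A /congruence_partP[AG Ac].
by apply/congruence_partP; rewrite gpredVr // congruent_to_oneV.
Qed.

Definition congruence_subgroup : groupClosed (SL 2 F) :=
  HB.pack congruence_part
    (isMul1Closed.Build (SL 2 F) congruence_part congruence_part1)
    (isMulClosed.Build (SL 2 F) congruence_part congruence_partM)
    (isInvClosed.Build (SL 2 F) congruence_part congruence_partV).
End Congruence.

Section FlatOrbit.
Local Open Scope classical_set_scope.
Local Open Scope ring_scope.
Variables (O : subringClosed F) (n : nat) (S : groupClosed (SL 2 F)).
Hypothesis S_congr : {subset S <= congruent_to_one O n}.
Variables (a b : F).
Hypotheses (aO : a \in O) (bO : b \in O).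

(** The flat from [a] to [b]. *)
Definition flat_form : 'M[F]_2 := (cusp_form b)^T *m cusp_form a.

(** [g] acts on points by [S |-> g *m S *m g^T], so [g^-1] acts on flats by this
    formula; taking all [g] in a group, the two orbits agree. *)
Definition flat_orbit : set 'M[F]_2 :=
  [set M | exists2 g : SL 2 F, g \in S & M = (val g)^T *m flat_form *m val g].

Lemma flat_form_orbit : flat_orbit flat_form.
Proof. by exists 1%g; rewrite ?gpred1 // /= trmx1 mul1mx mulmx1. Qed.

Lemma flat_orbit_act g M : g \in S -> flat_orbit M ->
  flat_orbit ((val g)^T *m M *m val g).
Proof.
move=> gS [h hS ->]; exists (h * g)%g; first exact: gpredM.
by rewrite /= trmx_mul !mulmxA.
Qed.

Lemma flat_orbit_bij g : g \in S ->
  set_bij flat_orbit flat_orbit (fun M => (val g)^T *m M *m val g).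
Proof.
move=> gS; have gVS : (g^-1)%g \in S by rewrite gpredV.
have actK (h : SL 2 F) M : (val (h^-1)%g)^T *m ((val h)^T *m M *m val h) *m val (h^-1)%g = M.
  have hV : val h *m val (h^-1)%g = 1%:M by exact: (congr1 val (mulgV h)).
  by rewrite -!mulmxA hV mulmx1 mulmxA -trmx_mul hV trmx1 mul1mx.
split=> [M|M M' _ _ /= E|M AM]; first exact: flat_orbit_act.
  by rewrite -[M](actK g) E; exact: actK.
exists ((val (g^-1)%g)^T *m M *m val (g^-1)%g); first exact: flat_orbit_act.
by have := actK (g^-1)%g M; rewrite invgK.
Qed.

Lemma flat_orbit_factors M : flat_orbit M -> exists2 g : SL 2 F, g \in S &
  M = (cusp_form b *m val g)^T *m (cusp_form a *m val g).
Proof.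
by case=> g gS ->; exists g; rewrite // trmx_mul /flat_form !mulmxA.
Qed.

Lemma flat_orbit_rank_one : rank_one_family O (a - b) flat_orbit.
Proof.
move=> M AM; have [g gS ME] := flat_orbit_factors AM.
have gO := congruent_to_one_integral (S_congr gS).
have formO e : e \in O -> forall j, (cusp_form e *m val g) 0 j \in O.
  by move=> eO j; rewrite mulmx2 !mxE /= !(rpredD, rpredM, rpredN, rpred1).
split.
- by move=> i j; rewrite ME mxE big_ord1 mxE rpredM // formO.
- by exists (cusp_form a *m val g), (cusp_form b *m val g).
rewrite ME !mxE !big_ord1 ![_^T _ _]mxE !mulmx2 !mxE /=.
have := SL_det g; rewrite det_mx2 => detg.
transitivity ((a - b) * (g 0 0 * g 1 1 - g 0 1 * g 1 0)); last by rewrite detg mulr1.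
by ring.
Qed.

Lemma cusp_value_factor (e : F) (g : SL 2 F) :
  cusp_value e ((cusp_form b *m val g)^T *m (cusp_form a *m val g)) =
  (cusp_form b *m val g *m cusp_vec e) 0 0 * (cusp_form a *m val g *m cusp_vec e) 0 0.
Proof.
move: (cusp_form b *m val g) (cusp_form a *m val g) => p q.
by rewrite cusp_valueE !mulmx2 !mxE !big_ord1 !mxE /=; ring.
Qed.

(** An element congruent to 1 moves [cusp_vec e] to a vector congruent to it
    modulo [n]. If [cusp_form c] vanishes there, the slopes [e] and [c] agree
    modulo [n]. *)
Lemma cusp_form_congr (e c : F) (g : SL 2 F) : c \in O -> e \in O -> g \in S ->
  (cusp_form c *m val g *m cusp_vec e) 0 0 = 0 ->
  exists2 x, x \in O & e - c = n%:R * x.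
Proof.
move=> cO eO /S_congr/congruent_to_oneP gS; rewrite !mulmx2 !mxE /=.
have [x x_O ->] := gS 0 0; have [y yO ->] := gS 0 1.
have [z zO ->] := gS 1 0; have [w wO ->] := gS 1 1 => /= E.
exists (c * (z * e + w) - (x * e + y)).
  by rewrite !(rpredB, rpredD, rpredM).
by rewrite -[LHS]subr0 -E; ring.
Qed.

(** A translate of the flat ending at [e] would make [e] congruent to [a] or [b]. *)
Lemma cusp_value_neq0 (e : F) M : e \in O ->
  (forall x, x \in O -> e - a != n%:R * x) ->
  (forall x, x \in O -> e - b != n%:R * x) ->
  flat_orbit M -> cusp_value e M != 0.
Proof.
move=> eO ea eb AM; have [g gS ->] := flat_orbit_factors AM.
rewrite cusp_value_factor mulf_eq0; apply/norP; split; apply/eqP.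
  by move=> /(cusp_form_congr bO eO gS)[x xO]; apply/eqP/eb.
by move=> /(cusp_form_congr aO eO gS)[x xO]; apply/eqP/ea.
Qed.

(** A translate ending at [a] does so with the end that comes from [a], since [b]
    is not congruent to [a]. *)
Lemma cusp_value_eq0 M : (forall x, x \in O -> a - b != n%:R * x) ->
  flat_orbit M -> cusp_value a M = 0 ->
  exists r : 'rV[F]_2, M = r^T *m cusp_form a.
Proof.
move=> ab AM; have [g gS ->] := flat_orbit_factors AM.
rewrite cusp_value_factor => /eqP; rewrite mulf_eq0 => /orP[/eqP|/eqP].
  by move=> /(cusp_form_congr bO aO gS)[x xO] /eqP; rewrite (negPf (ab x xO)).
set v := cusp_form a *m val g; rewrite mulmx2 ![cusp_vec _ _ _]mxE /= mulr1 => v0.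
exists (v 0 0 *: (cusp_form b *m val g)).
rewrite linearZ /= -scalemxAl scalemxAr; congr (_ *m _).
apply/rowP => j; rewrite [RHS]mxE [cusp_form a _ _]mxE; case/orP: (ord2 j) => /eqP ->.
  by rewrite mulr1.
rewrite /= mulrN; apply/eqP.
by rewrite -subr_eq0 opprK addrC v0.
Qed.

End FlatOrbit.
End SL2.

Section SeparatingModulus.
Variables (R : realType) (F : fieldType) (d : nat).
Variables (sigma : 'I_d -> {rmorphism F -> R}) (O : subringClosed F).
Hypothesis norm_ge1 : norm_bounded_below sigma O.
Variable i0 : 'I_d.

(** If [n] divides a nonzero integer, its norm is at least [n ^ d] in absolute
    value; so it is enough that [n] exceeds the norms of all differences. *)
Lemma separating_modulus (T : finType) (e : T -> F) :
  injective e -> exists2 n, (0 < n)%N &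
  forall t t' x, t != t' -> x \in O -> e t - e t' != n%:R * x.
Proof.
move=> e_inj; pose N t t' := \prod_(i < d) `|sigma i (e t - e t')|.
have N_ge0 t t' : 0 <= N t t' by apply: prodr_ge0.
pose n := (Num.truncn (\sum_t \sum_t' N t t')).+1.
exists n => // t t' x tt' xO; apply/eqP => E.
have nR : \sum_t \sum_t' N t t' < n%:R by exact: truncnS_gt.
have Nn : N t t' < n%:R.
  apply: le_lt_trans nR; rewrite (bigD1 t) //= (bigD1 t') //= -addrA lerDl.
  by rewrite addr_ge0 ?sumr_ge0 // => s _; apply: sumr_ge0.
have x0 : x != 0.
  by apply: contraNneq tt' => x0; rewrite -(inj_eq e_inj) -subr_eq0 E x0 mulr0.
have := norm_ge1 xO x0; apply/negP; rewrite -ltNge.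
have : n%:R * \prod_(i < d) `|sigma i x| <= N t t'.
  rewrite /N E; under [leRHS]eq_bigr do rewrite rmorphM rmorph_nat normrM normr_nat.
  rewrite big_split /= ler_wpM2r ?prodr_ge0 // (bigD1 i0) //= ler_peMr //.
  rewrite prodr_const -natrX ler1n expn_gt0.
  by [].
move=> /le_lt_trans/(_ Nn); rewrite -{2}[n%:R]mulr1 ltr_pM2l // ltr0n //.
Qed.
End SeparatingModulus.

Section CongruenceIndex.
Variables (R : realType) (F : fieldType) (d : nat).
Variables (sigma : 'I_d -> {rmorphism F -> R}) (O : subringClosed F).
Hypothesis norm_ge1 : norm_bounded_below sigma O.
Variable i0 : 'I_d.
Variable rho : R.
Hypothesis O_cobounded : forall y : 'I_d -> R, exists2 l, l \in O &
  forall i, `|sigma i l - y i| <= rho.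

(** Subtract [n] times an integer close to [x / n]. *)
Lemma bounded_residue n : (0 < n)%N -> exists r : F -> F, forall x, x \in O ->
  [/\ r x \in O, forall i, `|sigma i (r x)| <= n%:R * rho &
      exists2 b, b \in O & x = r x + n%:R * b].
Proof.
move=> n_gt0; have n0 : n%:R != 0 :> R by rewrite pnatr_eq0 -lt0n.
suff /choice[r rP] : forall x, exists y, x \in O ->
    [/\ y \in O, forall i, `|sigma i y| <= n%:R * rho &
      exists2 b, b \in O & x = y + n%:R * b] by exists r.
move=> x; have [l lO lx] := O_cobounded (fun i => sigma i x / n%:R).
exists (x - n%:R * l) => xO; split.
- by rewrite rpredB ?rpredM ?rpred_nat.
- move=> i; rewrite rmorphB rmorphM rmorph_nat.
  have -> : sigma i x - n%:R * sigma i l = n%:R * (sigma i x / n%:R - sigma i l).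
    by field.
  by rewrite normrM normr_nat ler_wpM2l // distrC.
by exists l => //; rewrite subrK.
Qed.

(** There are finitely many residues modulo [n], since all of them have bounded
    representatives; matrices with the same residues are in the same coset. *)
Lemma congruence_part_finite_index n (Gamma : groupClosed (SL 2 F)) (K : {pred SL 2 F}) :
  (0 < n)%N -> (forall A, reflect (A \in Gamma /\ forall i j, A i j \in O) (A \in K)) ->
  finite_index (congruence_part O n Gamma) K.
Proof.
move=> n_gt0 KP; have [r rP] := bounded_residue n_gt0.
apply: (@finite_index_map _ _ (fun A : SL 2 F => map_mx r (val A))).
- move=> A /congruence_partP[AG Ac]; apply/KP; split=> //.
  exact: congruent_to_one_integral Ac.
- apply: sub_finite_set (finite_bounded_integer_mx norm_ge1 i0 (n%:R * rho)).
  by move=> _ [A /KP[_ AO] <-] i j; rewrite mxE; have [] := rP _ (AO i j).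
have same A B : A \in K -> B \in K -> map_mx r (val A) = map_mx r (val B) ->
    (A^-1 * B)%g \in congruence_part O n Gamma.
  move=> /KP[AG AO] /KP[BG BO] AB; apply/congruence_partP; split.
    by rewrite gpredM // gpredV.
  apply/congruent_to_oneP => i j.
  have AV k : (A^-1)%g i k \in O.
    have [V00 V01 V10 V11] := SL2_invE A.
    case/orP: (ord2 i) => /eqP ->; case/orP: (ord2 k) => /eqP ->;
      by rewrite ?V00 ?V01 ?V10 ?V11 ?rpredN.
  have diff k : exists2 b, b \in O & B k j = A k j + n%:R * b.
    have [_ _ [a aO aE]] := rP _ (AO k j); have [_ _ [b bO bE]] := rP _ (BO k j).
    exists (b - a); first by rewrite rpredB.
    move/matrixP/(_ k j): AB; rewrite !mxE => AB.
    by rewrite aE bE AB; ring.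
  have [b0 b0O b0E] := diff 0; have [b1 b1O b1E] := diff 1.
  have VA : (A^-1)%g i 0 * A 0 j + (A^-1)%g i 1 * A 1 j = (i == j)%:R.
    by rewrite -mulmx2 -[_ *m _]/(val (A^-1 * A)%g) mulVg /= mxE.
  exists ((A^-1)%g i 0 * b0 + (A^-1)%g i 1 * b1); first by rewrite !(rpredD, rpredM).
  rewrite mulmx2 b0E b1E -VA; ring.
move=> A B AK BK AB; apply/seteqP; split=> [_ [h hS <-]|_ [h hS <-]].
  exists ((A^-1 * B)^-1 * h)%g; first by apply: congruence_partM => //; apply/congruence_partV/same.
  by rewrite invMg invgK !mulgA mulgV mul1g.
exists (A^-1 * B * h)%g; first by apply: congruence_partM => //; apply: same.
by rewrite !mulgA mulgV mul1g.
Qed.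
End CongruenceIndex.

(** * Cohomology classes of flats and their values on tori *)

Section TorusEvaluation.
Variables (K : numFieldType) (G : groupType) (n : nat).
Variables (x : 'I_n -> G) (pt : {set 'I_n} -> G).
Hypothesis ptU : forall j (B : {set 'I_n}), j \notin B -> pt (j |: B) = (x j * pt B)%g.

(** An invariant cochain is invariant under each step of the torus. *)
Lemma alt_sum_is_coboundary (f : cochain K G n) : is_coboundary f -> alt_sum f pt = 0.
Proof.
case: n x pt ptU f => [|m] x' pt' ptU' f /=.
  by move=> ->; apply: big1 => p _; rewrite mulr0.
move=> [h Ih ->]; apply: (alt_sum_coboundary (h := h)) => j A jA.
rewrite -[RHS](Ih (x' j)); congr h; apply/funext => k.
by rewrite ptU'.
Qed.

Definition torus_eval (z : cocycle K G n) : K^o := alt_sum (val z) pt.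

Lemma torus_eval_is_linear : linear torus_eval.
Proof.
move=> a y z; rewrite /torus_eval /alt_sum scaler_sumr -big_split.
by apply: eq_bigr => p _ /=; rewrite mulrDr [X in X + _]mulrCA.
Qed.
HB.instance Definition _ :=
  GRing.isLinear.Build K (cocycle K G n) K^o *:%R torus_eval torus_eval_is_linear.

Lemma torus_eval_coboundary z : coh_class z = 0 -> torus_eval z = 0.
Proof.
rewrite -[0](linear0 (@coh_class K G n)) => /coh_classP; rewrite subr0 => /asboolP.
exact: alt_sum_is_coboundary.
Qed.
End TorusEvaluation.

Section FlatCocycle.
Local Open Scope classical_set_scope.
Local Open Scope ring_scope.
Variables (R : realType) (F : fieldType) (d : nat) (K : numFieldType).
Variables (sigma : 'I_d -> {rmorphism F -> R}) (O : subringClosed F).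
Hypothesis norm_ge1 : norm_bounded_below sigma O.
Variables (i0 : 'I_d) (S : groupClosed (SL 2 F)).

Definition base_point (g : SL 2 F) : point R d := fun i =>
  map_mx (sigma i) (val g) *m (map_mx (sigma i) (val g))^T.

Lemma base_pointM (g h : SL 2 F) :
  base_point (g * h)%g = point_act sigma (val g) (base_point h).
Proof.
by apply/funext => i; rewrite /base_point /point_act map_mxM trmx_mul !mulmxA.
Qed.

Lemma base_point_bounded (g : SL 2 F) : exists C, point_bounded C (base_point g).
Proof.
apply: uniform_sym_bounded => i; apply: sym_bounded_gram.
by rewrite det_map_mx SL_det rmorph1.
Qed.

Variables (kappa : F) (A : set 'M[F]_2).
Hypothesis A_rank1 : rank_one_family O kappa A.
Hypothesis A_stable : forall g, g \in S ->
  set_bij A A (fun M => (val g)^T *m M *m val g).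

Definition flat_cochain : cochain K (subgroup_type S) d :=
  fun g => intersection K sigma A (fun j => base_point (val (g j))).

Lemma flat_cochain_cocycle : flat_cochain \in @cocycle_pred K (subgroup_type S) d.
Proof.
apply/asboolP; split=> [h g|].
  rewrite -[RHS](intersection_act K sigma _ (A_stable (valP h))).
  by congr intersection; apply/funext => j /=; rewrite -base_pointM.
apply/funext => g; have [C gC] : exists C, forall k, point_bounded C (base_point (val (g k))).
  by apply: uniform_point_bounded => k; apply: base_point_bounded.
exact: (intersection_cocycle K norm_ge1 i0 A_rank1 gC).
Qed.

Definition flat_cocycle : cocycle K (subgroup_type S) d :=
  Sub flat_cochain flat_cochain_cocycle.

Section Cusp.
Variables (c : F) (u : 'I_d -> F).
Hypothesis unipS : forall j, SL_unip c (u j) \in S.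

Lemma SL_unip_sum (B : {set 'I_d}) : SL_unip c (\sum_(j in B) u j) \in S.
Proof.
elim/big_rec: _ => [|j w _ wS]; first by rewrite SL_unip0 gpred1.
by rewrite SL_unipD gpredM.
Qed.

Definition unip_flag (B : {set 'I_d}) : subgroup_type S :=
  Sub (SL_unip c (\sum_(j in B) u j)) (SL_unip_sum B).

Lemma unip_flagU j (B : {set 'I_d}) : j \notin B ->
  unip_flag (j |: B) = (Sub (SL_unip c (u j)) (unipS j) * unip_flag B)%g.
Proof.
move=> jB; apply: val_inj; rewrite /= big_setU1 //; exact: SL_unipD.
Qed.

Lemma base_point_unip_flag B : base_point (val (unip_flag B)) = horoflag sigma c u 0 B.
Proof.
by apply/funext => i; rewrite /horoflag /cusp_point scale0r addr0.
Qed.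

Lemma alt_sum_flat_cochain : alt_sum flat_cochain unip_flag =
  alt_sum (intersection K sigma A) (horoflag sigma c u 0).
Proof.
apply: eq_bigr => p _; congr (_ * intersection _ _ _ _).
by apply/funext => j; exact: base_point_unip_flag.
Qed.
End Cusp.
End FlatCocycle.

Section Detection.
Local Open Scope classical_set_scope.
Local Open Scope ring_scope.
Variables (R : realType) (F : fieldType) (d : nat) (K : numFieldType).
Variables (sigma : 'I_d -> {rmorphism F -> R}) (O : subringClosed F).
Hypothesis norm_ge1 : norm_bounded_below sigma O.
Variables (i0 : 'I_d) (n : nat) (S : groupClosed (SL 2 F)).
Hypothesis S_congr : {subset S <= congruent_to_one O n}.
Variables (a b : F).
Hypotheses (aO : a \in O) (bO : b \in O).
Local Notation A := (flat_orbit S a b).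

Lemma flat_orbit_unip c u : SL_unip c u \in S ->
  set_bij A A (fun M => (unip c u)^T *m M *m unip c u).
Proof. exact: flat_orbit_bij. Qed.

(** No translate of the flat ends at [c]. *)
Lemma flat_undetected c u : c \in O ->
  (forall x, x \in O -> c - a != n%:R * x) ->
  (forall x, x \in O -> c - b != n%:R * x) ->
  (forall j, SL_unip c (u j) \in S) ->
  alt_sum (intersection K sigma A) (horoflag sigma c u 0) = 0.
Proof.
move=> cO ca cb uS.
rewrite (alt_sum_at_cusp K norm_ge1 i0 (flat_orbit_rank_one S_congr aO bO) cO
  (fun j => flat_orbit_unip (uS j))).
apply: big1 => p _; rewrite /intersection (_ : _ `&` _ = set0) ?fsbig_set0 ?mulr0 //.
apply/seteqP; split=> // M [AM /=]; apply/eqP.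
apply: (cusp_value_neq0 S_congr aO bO cO ca cb AM).
Qed.

(** All translates of the flat that end at [a] do so with the same end, so their
    contributions do not cancel. *)
Lemma flat_detected rho : 1 <= rho ->
  (forall x, x \in O -> a - b != n%:R * x) ->
  (forall y : 'I_d -> R, exists2 l, SL_unip a l \in S &
    forall i, `|sigma i l - y i| <= rho) ->
  exists2 u : 'I_d -> F, forall j, SL_unip a (u j) \in S &
  alt_sum (intersection K sigma A) (horoflag sigma a u 0) != 0.
Proof.
move=> rho_ge1 ab L_cobounded; pose A' := A `&` [set M | cusp_value a M = 0].
have A_rank1 := flat_orbit_rank_one S_congr aO bO.
have A'_rank1 : rank_one_family O (a - b) A' by move=> M [/A_rank1].
have A'_cusp M : A' M -> exists r : 'rV[F]_2, M = r^T *m cusp_form a.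
  by case=> AM; apply: (cusp_value_eq0 S_congr aO bO ab).
have ab0 : a - b != 0 by have := ab 0; rewrite mulr0; apply; exact: rpred0.
have A'_L l M : [set l | SL_unip a l \in S] l -> A' M ->
    A' ((unip a l)^T *m M *m unip a l).
  move=> /= lS [AM M0]; split; first exact: (flat_orbit_act (g := SL_unip a l)).
  rewrite /= /cusp_value -!mulmxA mxtrace_mulC -!mulmxA -trmx_mul unip_vec.
  by rewrite [unip a l *m _]mulmxA unip_vec.
have A'0 : A' (flat_form a b).
  split; first exact: flat_form_orbit.
  by rewrite /= cusp_valueE /flat_form !mxE !big_ord1 !mxE /=; ring.
have [u uS u_neq0] := horo_alt_sum_neq0 K norm_ge1 i0 A'_rank1 A'_cusp ab0 A'_L
  rho_ge1 L_cobounded A'0.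
exists u => //.
by rewrite (alt_sum_at_cusp K norm_ge1 i0 A_rank1 aO (fun j => flat_orbit_unip (uS j))).
Qed.
End Detection.

(** * Totally real Galois fields *)

(** Send a primitive element to a root of its minimal polynomial. *)
Lemma number_field_embedding (F : splittingFieldType rat) (C : numClosedFieldType) :
  separable 1%VS {:F}%VS -> exists f : F -> C, zmod_morphism f /\ monoid_morphism f.
Proof.
move=> F_sep; pose x := separable_generator 1%VS {:F}%VS.
have Fx : {:F}%VS = <<1; x>>%VS.
  by apply: eq_adjoin_separable_generator => //; apply: sub1v.
have [q Dq] := polyOver1P (minPolyOver 1%VS x).
have [z z_root] : exists z : C, root (map_poly ratr q) z.
  apply/closed_rootP; rewrite size_map_poly -(size_map_poly (in_alg F)) -Dq.
  by rewrite size_minPoly eqSS -lt0n.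
have eval0 g : (map_poly (in_alg F) g).[x] = 0 -> (map_poly ratr g).[z] = 0 :> C.
  move=> gx0; have : minPoly 1%VS x %| map_poly (in_alg F) g.
    by apply: minPoly_dvdp; [apply: alg_polyOver | apply/rootP].
  rewrite Dq dvdp_map => /dvdpP[h ->]; rewrite rmorphM hornerM.
  by rewrite (rootP z_root) mulr0.
have /choice[g gP] : forall y : F, exists g, y = (map_poly (in_alg F) g).[x].
  by move=> y; apply/Fadjoin1_polyP; rewrite -Fx memvf.
pose f y := (map_poly ratr (g y)).[z] : C.
have fE y h : y = (map_poly (in_alg F) h).[x] -> f y = (map_poly ratr h).[z].
  move=> yE; apply/eqP; rewrite -subr_eq0 -hornerN -hornerD -rmorphN -rmorphD.
  by apply/eqP/eval0; rewrite rmorphB hornerD hornerN -gP -yE subrr.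
exists f; split; [move=> a b|split; [|move=> a b]].
- rewrite (fE _ (g a - g b)); first by rewrite rmorphB hornerD hornerN.
  by rewrite rmorphB hornerD hornerN -!gP.
- by rewrite (fE _ 1) ?rmorph1 ?hornerC.
- rewrite (fE _ (g a * g b)); first by rewrite rmorphM hornerM.
  by rewrite rmorphM hornerM -!gP.
Qed.

Section Integers.
Variable F : splittingFieldType rat.
Implicit Types x y : F.

Definition integers : {pred F} := fun x => `[< integralOver (intr : int -> F) x >].

Lemma integersP x : reflect (integralOver (intr : int -> F) x) (x \in integers).
Proof. exact: asboolP. Qed.

Lemma integers_subring : subring_closed integers.
Proof.
split=> [|x y /integersP x_int /integersP y_int|x y /integersP x_int /integersP y_int];
  apply/integersP; [exact: integral1|exact: integral_sub|exact: integral_mul].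
Qed.
HB.instance Definition _ := GRing.isSubringClosed.Build F integers integers_subring.

Lemma gal_integers (s : gal_of {:F}) x : x \in integers -> s x \in integers.
Proof.
move=> /integersP/(integral_rmorph s)[p mon_p px0]; apply/integersP; exists p => //.
by rewrite (eq_map_poly (g := s \o intr)) // => m; apply/esym/rmorph_int.
Qed.

(** The rational integers are integrally closed. *)
Lemma rational_integer (a : rat) : a%:A \in integers -> a \is a Num.int.
Proof.
move=> /integersP[p mon_p pa0].
have pa0Q : root (map_poly (intr : int -> rat) p) a.
  move: pa0; rewrite -(fmorph_root (in_alg F) (map_poly intr p)) -map_poly_comp.
  by rewrite (eq_map_poly (f := in_alg F \o intr) (g := intr)) // => m; apply: (rmorph_int (in_alg F)).
have : (ratr a : algC) \in Aint.
  have root_a : root (map_poly (intr : int -> algC) p) (ratr a).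
    rewrite (eq_map_poly (g := ratr \o intr)) => [|m]; last exact/esym/ratr_int.
    by rewrite map_poly_comp fmorph_root.
  apply: root_monic_Aint root_a _ _; first exact: monic_map.
  by apply/polyOverP => i; rewrite coef_map /= rpred_int.
move=> /(Cint_rat_Aint (Crat_rat a))/intrP[m am]; apply/intrP; exists m.
by apply: (fmorph_inj (@ratr algC : {rmorphism rat -> algC})); rewrite /= am rmorph_int.
Qed.

Lemma intrF_eq0 (m : int) : (m%:~R == 0 :> F) = (m == 0).
Proof. by rewrite -(rmorph_int (in_alg F)) fmorph_eq0 intr_eq0. Qed.

(** If [l] is the leading coefficient of an integral polynomial with root [x],
    then [l * x] is a root of a monic one. *)
Lemma integer_multiple x : exists2 m : int, m != 0 & m%:~R * x \in integers.
Proof.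
have [q mon_q qx0] := alg_integral x.
have [p [a a0 qE]] := rat_poly_scale q.
have p0 : p != 0.
  by apply: contraTneq mon_q => p0; rewrite qE p0 rmorph0 scaler0 monicE lead_coef0 eq_sym oner_eq0.
have {qx0} px0 : root (map_poly (intr : int -> F) p) x.
  move: qx0; rewrite qE map_polyZ rootZ; last by rewrite fmorph_eq0 invr_eq0 intr_eq0.
  by rewrite -map_poly_comp (eq_map_poly (g := intr)) // => m; apply: (rmorph_int (in_alg F)).
pose l := lead_coef p; pose n := (size p).-1.
have sp : size p = n.+1 by rewrite prednK // size_poly_gt0.
have pxE : \sum_(i < n) (p`_i)%:~R * x ^+ i = - (l%:~R * x ^+ n) :> F.
  apply/eqP; rewrite -addr_eq0; move: px0; rewrite /root horner_coef.
  rewrite size_map_poly_id0 ?intrF_eq0 ?lead_coef_eq0 // sp big_ord_recr /=.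
  rewrite coef_map /= -[p`_n]/l; congr (_ + _ == 0).
  by apply: eq_bigr => i _; rewrite coef_map.
exists l; first by rewrite lead_coef_eq0.
(* The minimal polynomial scaled by [l ^ n.-1] and read in [l * x]. *)
pose r : {poly int} := \poly_(i < n.+1) (if (i < n)%N then p`_i * l ^+ (n.-1 - i) else 1).
have rn : r`_n = 1 by rewrite coef_poly ltnSn ltnn.
have sr : size r = n.+1 by rewrite size_poly_eq // ltnn oner_eq0.
have n_gt0 : (0 < n)%N.
  rewrite lt0n; apply: contraNneq p0 => n0; move: pxE; rewrite n0 big_ord0 expr0 mulr1.
  by move/esym/eqP; rewrite oppr_eq0 intrF_eq0 lead_coef_eq0.
apply/integersP; exists r; first by rewrite monicE lead_coefE sr rn.
apply/eqP; rewrite horner_coef size_map_poly_id0 ?intrF_eq0 ?lead_coef_eq0 -?size_poly_eq0 ?sr //.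
rewrite big_ord_recr /= coef_map /= rn mul1r exprMn.
rewrite (eq_bigr (fun i : 'I_n => l%:~R ^+ n.-1 * ((p`_i)%:~R * x ^+ i))); last first.
  move=> i _; rewrite coef_map coef_poly /= ltnS ltnW // ltn_ord rmorphM rmorphXn /=.
  rewrite -[n.-1 in RHS](@subnK i) ?exprD ?exprMn; first by ring.
  by rewrite -ltnS prednK.
by rewrite -mulr_sumr pxE mulrN mulrA -exprSr prednK // addNr.
Qed.
End Integers.

Section RealEmbeddings.
Variables (R : realType) (F : splittingFieldType rat).
Hypothesis F_galois : galois 1%VS {:F}%VS.

Lemma real_embedding : totally_real F R -> inhabited {rmorphism F -> R}.
Proof.
move=> F_real; have /and3P[_ F_sep _] := F_galois.
have [f [fB fM]] := number_field_embedding R[i] F_sep.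
pose fa := GRing.isZmodMorphism.Build F R[i] f fB.
pose fm := GRing.isMonoidMorphism.Build F R[i] f fM.
pose iota : {rmorphism F -> R[i]} := HB.pack f fa fm.
have fE x : f x = (complex.Re (f x))%:C%C by rewrite RRe_real // (F_real iota x).
have gB : zmod_morphism (fun x => complex.Re (f x)) by move=> x y; rewrite fB raddfB.
have gM : monoid_morphism (fun x => complex.Re (f x)).
  split=> [|x y]; first by rewrite fM.1.
  by rewrite fM.2 fE [f y]fE /= mul0r subr0.
pose ga := GRing.isZmodMorphism.Build F R _ gB.
pose gm := GRing.isMonoidMorphism.Build F R _ gM.
by constructor; exact: (HB.pack (fun x => complex.Re (f x)) ga gm).
Qed.

Lemma card_gal : #|'Gal({:F} / 1)%g| = \dim {:F}.
Proof. by rewrite -galois_dim // dimv1 divn1. Qed.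

(** The embeddings of a Galois extension in the reals are one of them composed
    with the automorphisms, and there are [\dim {:F}] of them. *)
Lemma gal_enumeration : exists s : 'I_(\dim {:F}) -> gal_of {:F}, bijective s.
Proof.
have cardT : #|{: gal_of {:F}}| = \dim {:F}.
  rewrite -card_gal; apply: eq_card => s; apply/esym; exact: mem_gal1.
exists (fun i => enum_val (cast_ord (esym cardT) i)).
exists (fun s => cast_ord cardT (enum_rank s)) => i.
  by rewrite enum_valK cast_ordKV.
by rewrite cast_ordK enum_rankK.
Qed.

Variables (tau : {rmorphism F -> R}) (s : 'I_(\dim {:F}) -> gal_of {:F}).
Hypothesis s_bij : bijective s.

Definition gal_embedding (i : 'I_(\dim {:F})) : {rmorphism F -> R} := tau \o s i.

(** The product of the conjugates of an integer is its norm, an integral rational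
    number. *)
Lemma gal_embedding_norm : norm_bounded_below gal_embedding (@integers F).
Proof.
move=> x x_int x0.
have normE : \prod_(i < \dim {:F}) s i x = galNorm 1 {:F} x.
  rewrite /galNorm (reindex s) /=; last exact: onW_bij.
  by apply: eq_bigl => i; rewrite mem_gal1.
have [a aE] : exists a : rat, galNorm 1 {:F} x = a%:A.
  by apply/vlineP; rewrite mem_galNorm ?memvf.
have a_int : a \is a Num.int.
  apply: (@rational_integer F); rewrite -aE -normE; apply: rpred_prod => i _.
  exact: gal_integers.
have a0 : a != 0.
  apply: contraNneq x0 => a0; move/eqP: aE.
  by rewrite a0 scale0r galNorm_eq0.
rewrite -normr_prod -rmorph_prod normE aE alg_num_field fmorph_rat -ratr_norm.
rewrite -[1](ratr_nat R 1) ler_rat.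
by have /intrP[m am] := a_int; rewrite am in a0 *; rewrite -intr_norm ler1z -gtz0_ge1 normr_gt0 -(intr_eq0 rat).
Qed.

(** Dedekind independence of the automorphisms gives [w_1, ..., w_d] whose vectors
    of conjugates form a basis. After scaling the [w_j] to integers, rounding the
    coordinates in this basis moves a vector by a bounded amount. *)
Lemma integers_cobounded : exists2 rho : R, 1 <= rho &
  forall y : 'I_(\dim {:F}) -> R, exists2 l, l \in @integers F &
    forall i, `|gal_embedding i l - y i| <= rho.
Proof.
set G := 'Gal({:F} / 1)%g.
have [w _ [w_unit _ _]] := gal_matrix G.
have /choice[m mP] : forall j, exists m : int, m != 0 /\ m%:~R * tnth w j \in @integers F.
  by move=> j; have [m] := integer_multiple (tnth w j); exists m.
set W := \matrix_(_, _) _ in w_unit.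
have Wtau_unit : map_mx tau W \in unitmx by rewrite map_unitmx.
pose rho := 1 + \sum_i \sum_j `|map_mx tau W i j| * `|(m j)%:~R|.
have abs_ge0 i : 0 <= \sum_j `|map_mx tau W i j| * `|(m j)%:~R : R|.
  by apply: sumr_ge0 => j _; rewrite mulr_ge0.
exists rho => [|y]; first by rewrite lerDl sumr_ge0.
have [s' sK s'K] := s_bij.
pose z := invmx (map_mx tau W) *m (\col_i y (s' (enum_val i))).
pose q j := Num.floor (z j 0 / (m j)%:~R).
exists (\sum_j (q j)%:~R * ((m j)%:~R * tnth w j)).
  by apply: rpred_sum => j _; rewrite rpredM ?rpred_int //; case: (mP j).
move=> i; have Gi : s i \in G by exact: mem_gal1.
pose a : 'I_#|G| := enum_rank_in Gi (s i).
have aE : enum_val a = s i by exact: enum_rankK_in.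
have yE : y i = \sum_j map_mx tau W a j * z j 0.
  have : (map_mx tau W *m z) a 0 = y i by rewrite mulKVmx // mxE aE sK.
  by rewrite mxE => <-.
have -> : gal_embedding i (\sum_j (q j)%:~R * ((m j)%:~R * tnth w j)) =
    \sum_j map_mx tau W a j * ((q j)%:~R * (m j)%:~R).
  rewrite rmorph_sum; apply: eq_bigr => j _; rewrite !rmorphM !rmorph_int /= !mxE aE.
  by rewrite mulrA mulrC.
rewrite yE -sumrB; apply: le_trans (ler_norm_sum _ _ _) _.
apply: (@le_trans _ _ (\sum_j `|map_mx tau W a j| * `|(m j)%:~R : R|)); last first.
  by rewrite /rho [\sum_i _](bigD1 a) //= addrCA lerDl addr_ge0 // sumr_ge0.
apply: ler_sum => j _; rewrite -mulrBr normrM ler_wpM2l //.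
have m0 : (m j)%:~R != 0 :> R by rewrite intr_eq0; case: (mP j).
have -> : (q j)%:~R * (m j)%:~R - z j 0 = (m j)%:~R * ((q j)%:~R - z j 0 / (m j)%:~R).
  by field.
rewrite normrM ler_piMr // distrC.
have /andP[ql qg] := floor_itv (z j 0 / (m j)%:~R).
by move: qg; rewrite intrD => /ltW qg; rewrite ger0_norm ?subr_ge0 // lerBlDl.
Qed.

End RealEmbeddings.

Section HilbertModular.
Variables (R : realType) (F : splittingFieldType rat).
Hypothesis F_galois : galois 1%VS {:F}%VS.
Local Notation d := (\dim {:F}).
Local Notation O := (@integers F).

Lemma gal_stable_congruence_part n (Gamma : groupClosed (SL 2 F)) :
  gal_stable Gamma -> gal_stable (congruence_part O n Gamma).
Proof.
move=> Gs s sG A /congruence_partP[AG /congruent_to_oneP AO].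
apply/congruence_partP; split; first exact: Gs.
apply/congruent_to_oneP => i j; have [b bO E] := AO i j.
exists (s b); first exact: gal_integers.
by rewrite mxE E rmorphD rmorphM !rmorph_nat.
Qed.

Lemma unip_in_SL_integers c u : c \in O -> u \in O -> SL_unip c u \in @SL_integers F 2.
Proof.
move=> cO uO; apply/asboolP => i j; apply/integersP.
rewrite -[_ i j]/(unip c u i j).
have [u00 u01 u10 u11] := unipE c u.
by case/orP: (ord2 i) => /eqP ->; case/orP: (ord2 j) => /eqP ->;
  rewrite ?u00 ?u01 ?u10 ?u11 ?(rpredN, rpredD, rpredM, rpredX, rpred1, rpredB).
Qed.

(** [N] comes from the finite index of the integral part of [Gamma] in [SL_2(O)]:
    the [N]-th power of a unipotent multiplies its parameter by [N]. *)
Lemma unip_in_congruence_part (Gamma : groupClosed (SL 2 F)) n :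
  arithmetic_subgroup Gamma -> exists2 N, (0 < N)%N & forall c u,
    c \in O -> u \in O -> SL_unip c ((N * n)%:R * u) \in congruence_part O n Gamma.
Proof.
move=> [_ fi].
have Kmul : mulg_closed (@SL_integers F 2).
  move=> A B /asboolP AO /asboolP BO; apply/asboolP => i j.
  by rewrite mulmx2; apply: integral_add; apply: integral_mul.
have K1 : 1%g \in @SL_integers F 2.
  by apply/asboolP => i j; rewrite mxE; apply: integral_nat.
have KX (x : SL 2 F) k : x \in @SL_integers F 2 -> (x ^+ k)%g \in @SL_integers F 2.
  by move=> xK; elim: k => [//|k IH]; rewrite expgS; apply: Kmul.
(* Congruence modulo 1 is integrality. *)
have {}fi : finite_index (congruence_part O 1 Gamma) (@SL_integers F 2).
  apply: eq_finite_index fi => A; apply/andP/congruence_partP => -[AG].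
    move=> /asboolP AO; split=> //; apply/congruent_to_oneP => i j.
    exists (A i j - (i == j)%:R); last by rewrite mul1r addrC subrK.
    by rewrite rpredB ?rpred_nat //; apply/integersP.
  move=> /congruent_to_one_integral AO; split=> //.
  by apply/asboolP => i j; apply/integersP.
have [N N_gt0 NK] := finite_index_exponent (H := congruence_subgroup O 1 Gamma) KX fi; exists N => // c u cO uO.
apply/congruence_partP; split.
  have : (SL_unip c (n%:R * u) ^+ N)%g \in congruence_part O 1 Gamma.
    by apply: NK; apply: unip_in_SL_integers; rewrite ?rpredM ?rpred_nat.
  rewrite -SL_unipX (_ : _ *+ N = (N * n)%:R * u); first by case/congruence_partP.
  by rewrite natrM -mulrA [RHS]mulr_natl.
apply/congruent_to_oneP => i j.
rewrite -[_ i j]/(unip c ((N * n)%:R * u) i j) natrM.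
have [u00 u01 u10 u11] := unipE c (N%:R * n%:R * u).
case/orP: (ord2 i) => /eqP ->; case/orP: (ord2 j) => /eqP -> /=.
- by exists (N%:R * u * c); rewrite ?u00 ?rpredM ?rpred_nat //; ring.
- by exists (- (N%:R * u * c ^+ 2)); rewrite ?u01 ?rpredN ?rpredM ?rpredX ?rpred_nat //; ring.
- by exists (N%:R * u); rewrite ?u10 ?rpredM ?rpred_nat //; ring.
by exists (- (N%:R * u * c)); rewrite ?u11 ?rpredN ?rpredM ?rpred_nat //; ring.
Qed.

Variables (tau : {rmorphism F -> R}) (s_ : 'I_d -> gal_of {:F}).
Hypothesis s_bij : bijective s_.
Local Notation sigma := (gal_embedding tau s_).

(** Prescribe approximate conjugates: integers whose conjugates are close to
    distinct multiples of [3 * rho], distinct also for distinct [k]. *)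
Lemma distinct_conjugates N : exists2 a : 'I_N -> F, forall k, a k \in O &
  injective (fun p : gal_of {:F} * 'I_N => p.1 (a p.2)).
Proof.
have [rho rho_ge1 rhoP] := integers_cobounded tau s_bij.
have /choice[a aP] : forall k : 'I_N, exists x, x \in O /\ forall i : 'I_d,
    `|sigma i x - 3 * rho * (i + d * k)%:R| <= rho.
  by move=> k; have [x] := rhoP (fun i => 3 * rho * (i + d * k)%:R); exists x.
exists a => [k|]; first by have [] := aP k.
have [s' s_K s'K] := s_bij.
move=> [t k] [t' l] /= E.
pose i := s' t; pose j := s' t'.
have [_ /(_ i)] := aP k; have [_ /(_ j)] := aP l.
rewrite -![sigma _ _]/(tau (s_ _ _)) /i /j !s'K -E.
move: (tau _) => z hl hk.
have ijE : (s' t + d * k)%N = (s' t' + d * l)%N.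
  apply/eqP; rewrite -(eqr_nat R); move: hl hk.
  set p := (_ + _)%N; set q := (_ + _)%N => hl hk; apply/negPn/negP => neq.
  have : 1 <= `|q%:R - p%:R : R|.
    by rewrite ler1_dist_nat // -(eqr_nat R).
  apply/negP; rewrite -ltNge ltr_norml; move: hl hk; rewrite !ler_norml.
  move: (p%:R) (q%:R) => P Q /andP[h1 h2] /andP[h3 h4].
  have pq1 : rho * (Q - P) * 3 <= rho * 2 by lra.
  have pq2 : - (rho * 2) <= rho * (Q - P) * 3 by lra.
  by apply/andP; split; nra.
have st : s' t = s' t'.
  apply/val_inj; have /(congr1 (modn^~ d)) := ijE.
  by rewrite ![(_ + d * _)%N]addnC ![(d * _)%N]mulnC !modnMDl !modn_small.
have tt' : t = t' by rewrite -(s'K t) st s'K.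
move: ijE; rewrite st => /addnI/eqP; rewrite eqn_pmul2l ?(leq_ltn_trans _ (ltn_ord (s' t))) //.
by rewrite tt' => /eqP/val_inj->.
Qed.

End HilbertModular.

Section GaloisPullback.
Variables (R : realType) (F : splittingFieldType rat).
Hypothesis F_galois : galois 1%VS {:F}%VS.
Local Notation d := (\dim {:F}).
Local Notation O := (@integers F).
Local Notation K := R[i].

Lemma gal_SL_unip (s : gal_of {:F}) c u : gal_SL s (SL_unip c u) = SL_unip (s c) (s u).
Proof. by apply: val_inj; rewrite /= map_unip. Qed.

Variables (tau : {rmorphism F -> R}) (s_ : 'I_d -> gal_of {:F}).
Hypothesis s_bij : bijective s_.
Local Notation sigma := (gal_embedding tau s_).

Variables (S : groupClosed (SL 2 F)) (S_stable : gal_stable S).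

(** An automorphism moves the torus at [c] with steps [u j] to the torus at
    [s c] with steps [s (u j)]. *)
Lemma alt_sum_gal_pullback (s : gal_of {:F}) c u
    (unipS : forall j, SL_unip c (u j) \in S)
    (unipS' : forall j, SL_unip (s c) (s (u j)) \in S) (f : cochain K (subgroup_type S) d) :
  alt_sum (cochain_pullback (gal_subgroup S_stable s) f) (unip_flag unipS) =
  alt_sum f (unip_flag unipS').
Proof.
apply: eq_bigr => p _; congr (_ * f _); apply/funext => k; apply: val_inj.
by rewrite /= gal_SL_unip rmorph_sum.
Qed.

End GaloisPullback.

(** * Embedding an irreducible representation *)

Section MatrixCoefficients.
Variables (K : fieldType) (gT : finGroupType) (G : {group gT}) (m : nat).
Variable theta : mx_representation K G m.

(** The vectors annihilated by all functionals [v |-> v *m theta s *m w] form a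
    submodule, which is not everything as [w] is not 0. *)
Lemma irreducible_functional (w : 'cV[K]_m) (v : 'rV[K]_m) :
  mx_irreducible theta -> w != 0 ->
  (forall s, s \in G -> v *m theta s *m w = 0) -> v = 0.
Proof.
move=> [_ _ theta_min] w0 vw; pose N := \matrix_(i < m, j < #|G|) (theta (enum_val j) *m w) i 0.
have colN j : col j N = theta (enum_val j) *m w.
  by apply/matrixP => i k; rewrite !mxE ord1.
have colM (u : 'rV_m) j : col j (u *m N) = u *m col j N.
  by apply/matrixP => i k; rewrite !mxE; apply: eq_bigr => l _; rewrite !mxE.
have kerP (u : 'rV_m) : reflect (forall s, s \in G -> u *m theta s *m w = 0) (u <= kermx N)%MS.
  apply: (iffP sub_kermxP) => [uN s sG|uw].
    by rewrite -mulmxA -[s](enum_rankK_in sG) // -colN -colM uN linear0.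
  apply/rowP => j; have := uw _ (enum_valP j); rewrite -mulmxA -colN -colM.
  by move/matrixP/(_ 0 0); rewrite !mxE.
have N_module : mxmodule theta (kermx N).
  apply/mxmoduleP => s sG; apply/row_subP => i; rewrite row_mul; apply/kerP => t tG.
  rewrite -[_ *m theta s *m _]mulmxA -repr_mxM //.
  by apply: (elimT (kerP _) (row_sub i _)); rewrite groupM.
apply/eqP; have vker : (v <= kermx N)%MS by apply/kerP.
apply: contraNT w0 => v0.
have kerN0 : kermx N != 0 by apply: contraNneq v0 => kerN0; rewrite -submx0 -kerN0.
have ker1 := theta_min _ N_module (submx1 _) kerN0.
apply/eqP/matrixP => i j; rewrite ord1 [RHS]mxE.
have ker_i : ((delta_mx 0 i : 'rV[K]_m) <= kermx N)%MS.
  exact: submx_trans (submx1 _) ker1.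
have := elimT (kerP _) ker_i _ (group1 G); rewrite repr_mx1 mulmx1 -rowE => /matrixP/(_ 0 0).
by rewrite !mxE.
Qed.

Section Map.
Variables (V : lmodType K) (act : gT -> V -> V) (w : 'cV[K]_m) (x : V).

(** The map from [theta] to the span of the orbit of [x] given by the matrix
    coefficients of [theta] at [w]. *)
Definition coefficient_map (v : 'rV[K]_m) : V :=
  \sum_(s in G) (v *m theta s^-1%g *m w) 0 0 *: act s x.

Lemma coefficient_map_is_linear : linear coefficient_map.
Proof.
move=> a v v'; rewrite /coefficient_map scaler_sumr -big_split.
apply: eq_bigr => s _ /=; rewrite scalerA -scalerDl !mulmxDl -!scalemxAl.
by congr (_ *: _); rewrite !mxE.
Qed.
HB.instance Definition _ :=
  GRing.isLinear.Build K 'rV[K]_m V *:%R coefficient_map coefficient_map_is_linear.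

Hypothesis act_linear : forall s, linear (act s).
Hypothesis actM : forall s t y, act (s * t)%g y = act t (act s y).

Lemma coefficient_map_equivariant t v : t \in G ->
  coefficient_map (v *m theta t) = act t (coefficient_map v).
Proof.
move=> tG; rewrite /coefficient_map.
have act0 : act t 0 = 0.
  by have := act_linear t (-1) 0 0; rewrite scaler0 addr0 scaleN1r addNr.
have act_sum I r (P : pred I) E :
    act t (\sum_(i <- r | P i) E i) = \sum_(i <- r | P i) act t (E i).
  apply: (big_morph (act t)) => // y z.
  by have := act_linear t 1 y z; rewrite !scale1r.
rewrite act_sum (reindex_inj (mulIg t)) /=; apply: eq_big => s; first by rewrite groupMr.
rewrite groupMr // => sG; rewrite actM.
have := act_linear t ((v *m theta s^-1%g *m w) 0 0) (act s x) 0.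
rewrite !addr0 act0 addr0 => ->; congr (_ *: _).
by rewrite -[v *m theta t *m _]mulmxA -repr_mxM ?groupV ?groupM // invMg mulKVg.
Qed.
End Map.
End MatrixCoefficients.

Theorem corollary1p4 (R : realType) (F : splittingFieldType rat)
    (F_galois : galois 1%VS {:F}%VS) (F_real : totally_real F R)
    (Gamma : groupClosed (SL 2 F))
    (Gamma_arith : arithmetic_subgroup Gamma) (Gamma_stable : gal_stable Gamma)
    (m : nat) (theta : mx_representation R[i] 'Gal({:F} / 1)%G m)
    (theta_irr : mx_irreducible theta) (B : nat) :
  exists (Gamma0 : groupClosed (SL 2 F)) (Gamma0_stable : gal_stable Gamma0),
    finite_index Gamma0 Gamma /\
    multiplicity_at_least theta
      (@gal_coh F 2 Gamma0 Gamma0_stable R[i] (\dim {:F})) B.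
Proof.
have [tau] := real_embedding F_galois F_real.
have [s_ s_bij] := gal_enumeration F_galois.
pose d := \dim {:F}; pose O := @integers F.
have i0 : 'I_d by exact: (Ordinal (adim_gt0 {:F}%AS)).
have norm_ge1 := gal_embedding_norm F_galois tau s_bij.
have [rho rho_ge1 rhoP] := integers_cobounded tau s_bij.
have [a aO a_inj] := distinct_conjugates tau s_bij (B + B).
have [n n_gt0 a_sep] := separating_modulus norm_ge1 i0 a_inj.
have [N N_gt0 unipS] := unip_in_congruence_part n Gamma_arith.
pose S := congruence_subgroup O n Gamma.
have S_stable : gal_stable S by exact: gal_stable_congruence_part Gamma_stable.
exists S, S_stable; split.
  have [fi _] := Gamma_arith.
  apply: finite_index_trans fi.
    apply/andP; split; first exact: gpred1.
    by apply/asboolP => i j; rewrite mxE; apply: integral_nat.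
  apply: (congruence_part_finite_index norm_ge1 i0 rhoP n_gt0) => A.
  apply: (iffP andP) => -[AG AO]; split=> //.
    by move: AO => /asboolP AO i j; apply/integersP; apply: AO.
  by apply/asboolP => i j; apply/integersP; apply: AO.
pose sigma := gal_embedding tau s_.
have S_congr : {subset S <= congruent_to_one O n} by move=> A /congruence_partP[].
pose c k := a (lshift B k); pose c' k := a (rshift B k).
pose L k := flat_orbit S (c k) (c' k).
have L_rank1 k := flat_orbit_rank_one S_congr (aO (lshift B k)) (aO (rshift B k)).
have L_stable k g (gS : g \in S) := flat_orbit_bij (c k) (c' k) gS.
pose z k : cocycle R[i] (subgroup_type S) d :=
  flat_cocycle R[i] norm_ge1 i0 (L_rank1 k) (L_stable k).
have a_sep1 (e e' : 'I_(B + B)) x : e != e' -> x \in O -> a e - a e' != n%:R * x.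
  move=> ee' xO; have := a_sep (1%g, e) (1%g, e') x; rewrite /= !gal_id; apply => //.
  by rewrite xpair_eqE negb_and ee' orbT.
have NnR : 1 <= (N * n)%:R :> R by rewrite ler1n muln_gt0 N_gt0.
have Nn0 : (N * n)%:R != 0 :> R by rewrite gt_eqF // (lt_le_trans ltr01).
have detected k : exists u : 'I_d -> F, (forall j, SL_unip (c k) (u j) \in S) /\
    alt_sum (intersection R[i] sigma (L k)) (horoflag sigma (c k) u 0) != 0.
  have [||y|u uS u0] := flat_detected R[i] norm_ge1 i0 S_congr
    (aO (lshift B k)) (aO (rshift B k)) (rho := (N * n)%:R * rho).
  - by rewrite mulr_ege1.
  - by move=> x; apply: a_sep1; rewrite eq_lrshift.
  - have [l lO ly] := rhoP (fun i => y i / (N * n)%:R).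
    exists ((N * n)%:R * l) => [|i]; first exact: unipS.
    rewrite rmorphM rmorph_nat.
    have -> : (N * n)%:R * sigma i l - y i = (N * n)%:R * (sigma i l - y i / (N * n)%:R).
      by rewrite mulrBr mulrCA mulfV // mulr1.
    by rewrite normrM normr_nat ler_wpM2l.
  by exists u.
have {detected}/choice[u uP] := detected.
have uS k j : SL_unip (c k) (u k j) \in S by have [] := uP k.
have galS (t : gal_of {:F}) e x : SL_unip e x \in S -> SL_unip (t e) (t x) \in S.
  by rewrite -gal_SL_unip; apply: S_stable; apply: mem_gal1.
have m_gt0 : (0 < m)%N.
  have [_ + _] := theta_irr; apply: contraR => m0; apply/eqP/matrixP => i.
  by rewrite (leq_ltn_trans (leq0n i) (ltn_ord i)) in m0.
(* Any nonzero vector would do. *)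
pose w : 'cV[R[i]]_m := const_mx 1.
have w0 : w != 0.
  by apply/eqP => /matrixP/(_ (Ordinal m_gt0) 0); rewrite !mxE => /eqP; rewrite oner_eq0.
pose j k : {linear 'rV[R[i]]_m -> cohomology R[i] (subgroup_type S) d} :=
  coefficient_map theta (@gal_coh F 2 S S_stable R[i] d) w (coh_class (z k)).
exists j; split=> [k s v sG|v sum0 l].
  apply: coefficient_map_equivariant => //; [exact: gal_coh_linear|exact: gal_cohM].
apply: (irreducible_functional theta_irr w0) => s sG.
pose t := s^-1%g.
have tS i : SL_unip (t (c l)) (t (u l i)) \in S by exact: galS.
pose coef k (q : gal_of {:F}) := (v k *m theta q^-1%g *m w) 0 0.
pose pull k q := cocycle_pullback (gal_subgroup S_stable q^-1%g) (z k).
have : coh_class (\sum_k \sum_(q in 'Gal({:F} / 1)%g) coef k q *: pull k q) = 0.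
  rewrite -sum0 linear_sum; apply: eq_bigr => k _; rewrite linear_sum.
  apply: eq_bigr => q _; rewrite linearZ /=; congr (_ *: _).
  by rewrite /gal_coh coh_pullback_class.
move=> /(torus_eval_coboundary (@unip_flagU _ _ _ _ _ tS)).
rewrite linear_sum.
(* The value at [t (c l)] of the translate by [q] of the class of the flat [k]. *)
have eval_pull k q : torus_eval (unip_flag tS) (pull k q) =
    if (k == l) && (q == t) then alt_sum (intersection R[i] sigma (L l)) (horoflag sigma (c l) (u l) 0)
    else 0.
  rewrite /torus_eval.
  have qS i : SL_unip (q^-1%g (t (c l))) (q^-1%g (t (u l i))) \in S by apply/galS/galS.
  rewrite [val _]/= (alt_sum_gal_pullback S_stable tS qS) alt_sum_flat_cochain.
  have act_comp x : q^-1%g (t x) = (t * q^-1)%g x by rewrite galM ?memvf.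
  case: (altP andP) => [[/eqP-> /eqP->]|/nandP kq].
    have tK x : t^-1%g (t x) = x by rewrite -galM ?memvf // mulgV gal_id.
    by rewrite tK (_ : (fun i => _) = u l) //; apply/funext => i; rewrite tK.
  apply: (flat_undetected _ norm_ge1 i0 S_congr (aO _) (aO _) _ _ _ qS).
  - by do 2!apply: gal_integers; apply: aO.
  - move=> x xO; have := a_sep ((t * q^-1)%g, lshift B l) (1%g, lshift B k) x.
    rewrite /= gal_id -act_comp; apply => //; rewrite xpair_eqE negb_and.
    case: kq => [kl|qt]; apply/orP; [right|left].
      by rewrite (inj_eq (@lshift_inj _ _)) eq_sym.
    by rewrite -(inj_eq (mulIg q)) mulgKV mul1g eq_sym.
  move=> x xO; have := a_sep ((t * q^-1)%g, lshift B l) (1%g, rshift B k) x.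
  rewrite /= gal_id -act_comp; apply => //.
  by rewrite xpair_eqE eq_lrshift andbF.
rewrite (eq_bigr (fun k => \sum_(q in 'Gal({:F} / 1)%g) coef k q *
    (if (k == l) && (q == t) then alt_sum (intersection R[i] sigma (L l))
       (horoflag sigma (c l) (u l) 0) else 0))); last first.
  move=> k _; rewrite linear_sum; apply: eq_bigr => q _.
  by rewrite linearZ /= eval_pull.
rewrite (bigD1 l) //= [X in _ + X]big1 ?addr0; last first.
  by move=> k kl; apply: big1 => q _; rewrite (negPf kl) mulr0.
rewrite (bigD1 t) /=; last by rewrite mem_gal1.
rewrite [X in _ + X]big1 ?addr0; last first.
  by move=> q /andP[_ qt]; rewrite (negPf qt) andbF mulr0.
rewrite !eqxx /= => /eqP; rewrite mulf_eq0 (negPf (uP l).2) orbF /coef /t invgK => /eqP E.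
by apply/matrixP => x y; rewrite !ord1 E mxE.
Qed.
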